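(* Let the data, standing assumptions, mesh and operators $\mathcal S_{n,i}^{a,b}$, $S_{n,i}$, $S_{n,i}^{\partial}$ be as in the context. Let $\phi$ be the restriction to $[0,T]\times\overline{\mathcal O}$ of a $C^3$ function defined on a fixed neighbourhood of that set, with bounded derivatives (up to order three), and write $\phi_{n,i}=\phi(t_n,x_i)$, $D\phi_{n,i}=D\phi(t_n,x_i)$, $D^2\phi_{n,i}=D^2\phi(t_n,x_i)$, and $$\mathcal A_{n,i}^a[\phi]:=-\partial_t\phi(t_n,x_i)+\mathcal H(t_n,x_i,D\phi_{n,i},D^2\phi_{n,i},\phi_{n,i},a).$$ For sufficiently small $\Delta t$ and $h$, the following hold for $n=0,\dots,N_T-1$, with remainder constants uniform in $n$, in the indicated nodes and in the controls. (I) Interior nodes. For $i\in\mathcal I_h^\circ$, $a\in A$, $b\in B$, $$\mathcal S_{n,i}^{a,b}[\phi(t_{n+1},\cdot)|_{\mathcal G_h}]-\phi_{n,i}=-\Delta t\,\mathcal A_{n,i}^a[\phi]-\frac1P\sum_{p=1}^P\widetilde d_{n,i}^p(a,b)\,\widetilde{\mathcal L}_{n,i}^p[\phi](a,b)+\frac1P\sum_{p=1}^P\big(\widetilde d_{n,i}^p(a,b)\big)^2\,\widetilde{\mathcal R}_{n,i}^p[\phi](a,b)+O(\Delta t^{3/2}+h^2).$$ Consequently, $$S_{n,i}[\phi(t_{n+1},\cdot)|_{\mathcal G_h}]-\phi_{n,i}=-\sup_{a\in A,\,b\in B}\Big\{\Delta t\,\mathcal A_{n,i}^a[\phi]+\frac1P\sum_{p=1}^P\widetilde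 d_{n,i}^p(a,b)\,\widetilde{\mathcal L}_{n,i}^p[\phi](a,b)-\frac1P\sum_{p=1}^P\big(\widetilde d_{n,i}^p(a,b)\big)^2\,\widetilde{\mathcal R}_{n,i}^p[\phi](a,b)\Big\}+O(\Delta t^{3/2}+h^2).$$ (II) Boundary nodes. For $i\in\mathcal I_h^\partial$, $$S_{n,i}^{\partial}[\phi(t_n,\cdot)|_{\mathcal G_h}]-\phi_{n,i}=-\ell_h\sup_{b\in B}\mathcal L(t_n,x_i,D\phi_{n,i},\phi_{n,i},b)+O(h^2).$$
   Context: **Data and standing assumptions.** $T>0$; $\mathcal O\subset\mathbb R^N$ is a nonempty bounded domain with boundary of class $C^3$; $n(x)$ is the unit outward normal at $x\in\partial\mathcal O$; $A\subset\mathbb R^{N_A}$, $B\subset\mathbb R^{N_B}$ are nonempty compact sets; $1\le N_p\le N$. The functions $\sigma:[0,T]\times\overline{\mathcal O}\times A\to\mathbb R^{N\times N_p}$, $\mu:[0,T]\times\overline{\mathcal O}\times A\to\mathbb R^N$, $f,r:[0,T]\times\overline{\mathcal O}\times A\to\mathbb R$, $g,k:[0,T]\times\partial\mathcal O\times B\to\mathbb R$, $\Psi:\overline{\mathcal O}\to\mathbb R$ are continuous; $\sigma(\cdot,\cdot,a)$ and $\mu(\cdot,\cdot,a)$ are Lipschitz with constants independent of $a\in A$; $r\ge0$ and $k\ge0$. The map $\gamma:\partial\mathcal O\times\mathcal V\to\mathbb R^N$, with $\mathcal V\subseteq\mathbb R^{N_B}$ open and $B\subset\mathcal V$, is of class $C^1$,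 and $|\gamma(x,b)|=1$, $\langle n(x),\gamma(x,b)\rangle>0$ for all $(x,b)\in\partial\mathcal O\times B$. Write $\gamma_b(x)=\gamma(x,b)$. **Control-resolved operators.** $$\mathcal H(t,x,p,M,z,a)=-\tfrac12\operatorname{Tr}(\sigma\sigma^\top(t,x,a)M)-\mu(t,x,a)\cdot p+r(t,x,a)z-f(t,x,a),$$ $$\mathcal L(t,x,p,z,b)=\gamma(x,b)\cdot p+k(t,x,b)z-g(t,x,b),$$ $$\mathcal R(t,x,p,z,b)=\tfrac12k(t,x,b)^2z-\tfrac12k(t,x,b)g(t,x,b)+\tfrac12k(t,x,b)\gamma(x,b)\cdot p.$$ **Mesh and interpolation.** For each $h$, $\mathcal O_h$ is a polyhedral approximation of $\mathcal O$ with a shape-regular simplicial triangulation $\mathbb T_h$, $h=\max_{\mathsf T\in\mathbb T_h}\operatorname{diam}\mathsf T$, whose vertices $\mathcal G_h=\{x_i:i\in\mathcal I_h\}$ lie in $\overline{\mathcal O}$; $\mathcal I_h=\mathcal I_h^\circ\,\dot\cup\,\mathcal I_h^\partial$ with $x_i\in\mathcal O$ for $i\in\mathcal I_h^\circ$, $x_i\in\partial\mathcal O$ for $i\in\mathcal I_h^\partial$. $\widehat{\mathbb T}_h$ is the associated exact triangulation of $\overline{\mathcal O}$ with the same vertices and possibly curved boundary elements, and $p_h:\overline{\mathcal O}\to\overline{\mathcal O_h}$ maps each element of $\widehat{\mathbb T}_h$ to the corresponding simplex of $\mathbb T_h$, fixing the vertices. With $\{\psi_j\}$ the continuous piecewise-linear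 nodal basis on $\mathbb T_h$, $I_h[V](x)=\sum_{j\in\mathcal I_h}\psi_j(p_h(x))V_j$ for $x\in\overline{\mathcal O}$ and a grid vector $V$. The mesh family satisfies $\|I_h[\varphi|_{\mathcal G_h}]-\varphi\|_{L^\infty(\overline{\mathcal O})}\le C_\varphi h^2$ for all $\varphi\in C^2(\overline{\mathcal O})$, where $C_\varphi$ is independent of $h$ and bounded by a constant times $\|\varphi\|_{C^2}$. Time grid: $\Delta t=T/N_T$, $t_n=n\Delta t$. **Oblique projection.** There are $R,\delta>0$ such that for every $x$ with $\operatorname{dist}(x,\partial\mathcal O)<R$ and every $b\in B$ there is a unique pair $(p^{\gamma_b}(x),d^{\gamma_b}(x))\in\partial\mathcal O\times(-\delta,\delta)$ with $x=p^{\gamma_b}(x)+d^{\gamma_b}(x)\gamma_b(p^{\gamma_b}(x))$; both are $C^1$ in $(x,b)$. **Branches.** Let $m=N_p$, $P=2^m$, and let $\xi^1,\dots,\xi^P$ be the elements of $\{-1,1\}^m$. For $i\in\mathcal I_h^\circ$, $a\in A$, $b\in B$ put $X^{*,p}=x_i+\Delta t\,\mu(t_n,x_i,a)+\sqrt{\Delta t}\,\sigma(t_n,x_i,a)\xi^p$. If $X^{*,p}\in\overline{\mathcal O}$ (non-exiting), set $\widetilde X_p=X^{*,p}$ and $\widetilde d_p=\widetilde k_p=\widetilde g_p=0$. If $X^{*,p}\notin\overline{\mathcal O}$ (exiting), set $x_b^p=p^{\gamma_b}(X^{*,p})$, $\widetilde d_p=2d^{\gamma_b}(X^{*,p})$,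 $\widetilde X_p=X^{*,p}-\widetilde d_p\gamma_b(x_b^p)$, $\widetilde k_p=k(t_n,x_b^p,b)$, $\widetilde g_p=g(t_n,x_b^p,b)$. The full notation for $\widetilde d_p$ is $\widetilde d_{n,i}^p(a,b)$. For $\Delta t$ small enough these are well defined with $\widetilde X_p\in\overline{\mathcal O}$. On an exiting branch put $$\widetilde{\mathcal L}_{n,i}^p[\phi](a,b)=\mathcal L(t_n,x_b^p,D\phi(t_n,x_b^p),\phi(t_n,x_b^p),b),\qquad\widetilde{\mathcal R}_{n,i}^p[\phi](a,b)=\mathcal R(t_n,x_b^p,D\phi(t_n,x_b^p),\phi(t_n,x_b^p),b),$$ and on a non-exiting branch both are $0$. **Scheme operators.** For a grid vector $V$ and $i\in\mathcal I_h^\circ$, $$\mathcal S_{n,i}^{a,b}[V]=\frac{1}{1+r(t_n,x_i,a)\Delta t}\frac1P\sum_{p=1}^P\big[e^{-\widetilde k_p\widetilde d_p}I_h[V](\widetilde X_p)+\widetilde d_pe^{-\widetilde k_p\widetilde d_p/2}\widetilde g_p\big]+\Delta t\,f(t_n,x_i,a),\qquad S_{n,i}[V]=\inf_{(a,b)\in A\times B}\mathcal S_{n,i}^{a,b}[V].$$ Fix constants $0<c_0\le c_1$ and an offset $\ell_h$, independent of $\Delta t$, with $c_0h\le\ell_h\le c_1h$. For $i\in\mathcal I_h^\partial$ (and $h$ small, so that $x_i-\ell_h\gamma(x_i,b)\in\mathcal O$), $$S_{n,i}^{\partial}[V]=\inf_{b\in B}\frac{I_h[V](x_i-\ell_h\gamma(x_i,b))+\ell_hg(t_n,x_i,b)}{1+\ell_hk(t_n,x_i,b)}.$$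 **$O$-notation.** $O(\Delta t^{3/2}+h^2)$ denotes a quantity bounded by $C(\Delta t^{3/2}+h^2)$ with $C$ independent of $\Delta t,h,n,i,a,b$ (it may depend on $\phi$ and the data); similarly for $O(h^2)$. *)

(* Defs.v *)
From HB Require Import structures.
From mathcomp Require Import all_boot all_order all_algebra.
From mathcomp Require Import all_classical all_reals all_analysis.

Set Implicit Arguments.
Unset Strict Implicit.
Unset Printing Implicit Defensive.

Import Order.TTheory GRing.Theory Num.Theory.
Import numFieldNormedType.Exports.

Local Open Scope classical_set_scope.
Local Open Scope ring_scope.

(* Points and vectors of R^n are row vectors, so the product of the matrix sigma
   with a column vector xi is written xi *m sigma^T.  The library norm on
   matrices is the sup norm; the Euclidean norm is enorm below. *)

Section Euclidean.
Context {R : realType}.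

Definition dot n (u v : 'rV[R]_n) : R := \sum_(i < n) u 0 i * v 0 i.

Definition enorm n (u : 'rV[R]_n) : R := Num.sqrt (dot u u).

Definition edist n (x : 'rV[R]_n) (S : set 'rV[R]_n) : R :=
  inf [set enorm (x - y) | y in S].

Definition ediam n (S : set 'rV[R]_n) : R :=
  sup [set enorm (x - y) | x in S & y in S].

Definition boundary n (S : set 'rV[R]_n) : set 'rV[R]_n :=
  closure S `\` interior S.

End Euclidean.

Section Smoothness.
Context {R : realType}.

(* D_{v_1} ... D_{v_k} f for s = [:: v_1; ...; v_k]. *)
Definition iter_derive {V W : normedModType R} (s : seq V) (f : V -> W) :
    V -> W :=
  foldr (fun v h => 'D_v h) f s.

(* f is of class C^k on the open set U: all iterated directional derivatives of
   order at most k exist and are continuous on U.  In finite dimension this is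
   the usual notion. *)
Definition Ck {V W : normedModType R} (k : nat) (U : set V) (f : V -> W) :
    Prop :=
  forall (s : seq V) (x : V), U x -> (size s <= k)%N ->
    {for x, continuous (iter_derive s f)} /\
    ((size s < k)%N -> forall v : V, derivable (iter_derive s f) x v).

(* Class C^1 on a set that need not be open (e.g. a hypersurface): f has, near
   each point of S, a C^1 extension to an open set. *)
Definition C1_on {V W : normedModType R} (S : set V) (f : V -> W) : Prop :=
  forall z, S z -> exists (U : set V) (G : V -> W),
    [/\ open U, U z, Ck 1 U G & forall y, U y -> S y -> G y = f y].

Definition basis_vec n (i : 'I_n) : 'rV[R]_n := delta_mx 0 i.

Definition grad n (f : 'rV[R]_n -> R) (x : 'rV[R]_n) : 'rV[R]_n :=
  \row_i iter_derive [:: basis_vec i] f x.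

Definition hess n (f : 'rV[R]_n -> R) (x : 'rV[R]_n) : 'M[R]_n :=
  \matrix_(i, j) iter_derive [:: basis_vec i; basis_vec j] f x.

(* f belongs to C^k(closure O), O open: f is C^k in O and f and all its
   derivatives of order at most k extend continuously to closure O. *)
Definition Ck_closure n (k : nat) (O : set 'rV[R]_n) (f : 'rV[R]_n -> R) :
    Prop :=
  [/\ Ck k O f,
      {within closure O, continuous f} &
      forall s : seq 'rV[R]_n, (size s <= k)%N ->
        exists G : 'rV[R]_n -> R,
          {within closure O, continuous G} /\
          (forall x, O x -> G x = iter_derive s f x)].

(* The C^k norm: supremum over O of all partial derivatives of order <= k. *)
Definition Ck_norm n (k : nat) (O : set 'rV[R]_n) (f : 'rV[R]_n -> R) : R :=
  sup [set `|iter_derive (map (@basis_vec n) s) f x| |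
        s in [set s : seq 'I_n | (size s <= k)%N] & x in O].

Definition local_defining n (O U : set 'rV[R]_n) (rho : 'rV[R]_n -> R) :
    Prop :=
  [/\ open U, Ck 3 U rho,
      forall y, U y -> grad rho y != 0,
      forall y, U y -> (O y <-> rho y < 0) &
      forall y, U y -> (boundary O y <-> rho y = 0)].

Definition C3_boundary n (O : set 'rV[R]_n) : Prop :=
  forall x, boundary O x ->
    exists (U : set 'rV[R]_n) (rho : 'rV[R]_n -> R),
      U x /\ local_defining O U rho.

Definition unit_outward_normal n (O : set 'rV[R]_n) (x nu : 'rV[R]_n) : Prop :=
  exists (U : set 'rV[R]_n) (rho : 'rV[R]_n -> R),
    [/\ U x, local_defining O U rho &
        nu = (enorm (grad rho x))^-1 *: grad rho x].

End Smoothness.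

Record control_data (R : realType) (N Np NA NB : nat) := ControlData {
  horizon : R;
  dom : set 'rV[R]_N;
  normal : 'rV[R]_N -> 'rV[R]_N;
  ctrlA : set 'rV[R]_NA;
  ctrlB : set 'rV[R]_NB;
  nbhdB : set 'rV[R]_NB;  (* the open set V containing B *)
  sigma : R -> 'rV[R]_N -> 'rV[R]_NA -> 'M[R]_(N, Np);
  mu : R -> 'rV[R]_N -> 'rV[R]_NA -> 'rV[R]_N;
  cost_f : R -> 'rV[R]_N -> 'rV[R]_NA -> R;
  rate_r : R -> 'rV[R]_N -> 'rV[R]_NA -> R;
  cost_g : R -> 'rV[R]_N -> 'rV[R]_NB -> R;
  rate_k : R -> 'rV[R]_N -> 'rV[R]_NB -> R;
  Psi : 'rV[R]_N -> R;
  gam : 'rV[R]_N -> 'rV[R]_NB -> 'rV[R]_N;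
  radius : R;             (* R in the oblique projection property *)
  delta : R;
  proj_pt : 'rV[R]_N -> 'rV[R]_NB -> 'rV[R]_N;  (* p^{gamma_b}(x) *)
  proj_dist : 'rV[R]_N -> 'rV[R]_NB -> R        (* d^{gamma_b}(x) *)
}.

Section Data.
Context {R : realType} {N Np NA NB : nat}.
Variable D : control_data R N Np NA NB.

Local Notation O := (dom D).
Local Notation A := (ctrlA D).
Local Notation B := (ctrlB D).

Definition times : set R := [set t | 0 <= t <= horizon D].

Definition closedQ : set (R * 'rV[R]_N) := times `*` closure O.

Definition closedQA : set (R * 'rV[R]_N * 'rV[R]_NA) := closedQ `*` A.

Definition lateralB : set (R * 'rV[R]_N * 'rV[R]_NB) :=
  (times `*` boundary O) `*` B.

Definition collar : set 'rV[R]_N :=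
  [set x | edist x (boundary O) < radius D].

Record standing : Prop := Standing {
  Np_bounds : (1 <= Np <= N)%N;
  horizon_gt0 : 0 < horizon D;
  dom_nonempty : O !=set0;
  dom_open : open O;
  dom_connected : connected O;
  dom_bounded : bounded_set O;
  dom_C3 : C3_boundary O;
  normalP : forall x, boundary O x -> unit_outward_normal O x (normal D x);
  ctrlA_nonempty : A !=set0;
  ctrlA_compact : compact A;
  ctrlB_nonempty : B !=set0;
  ctrlB_compact : compact B;
  sigma_continuous :
    {within closedQA, continuous (fun q => sigma D q.1.1 q.1.2 q.2)};
  mu_continuous :
    {within closedQA, continuous (fun q => mu D q.1.1 q.1.2 q.2)};
  f_continuous :
    {within closedQA, continuous (fun q => cost_f D q.1.1 q.1.2 q.2)};
  r_continuous :
    {within closedQA, continuous (fun q => rate_r D q.1.1 q.1.2 q.2)};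
  g_continuous :
    {within lateralB, continuous (fun q => cost_g D q.1.1 q.1.2 q.2)};
  k_continuous :
    {within lateralB, continuous (fun q => rate_k D q.1.1 q.1.2 q.2)};
  Psi_continuous : {within closure O, continuous (Psi D)};
  sigma_lipschitz : exists L : R, forall a, A a ->
    L.-lipschitz_closedQ (fun q : R * 'rV[R]_N => sigma D q.1 q.2 a);
  mu_lipschitz : exists L : R, forall a, A a ->
    L.-lipschitz_closedQ (fun q : R * 'rV[R]_N => mu D q.1 q.2 a);
  r_ge0 : forall t x a, closedQA (t, x, a) -> 0 <= rate_r D t x a;
  k_ge0 : forall t x b, lateralB (t, x, b) -> 0 <= rate_k D t x b;
  nbhdB_open : open (nbhdB D);
  nbhdB_sub : B `<=` nbhdB D;
  gam_C1 : C1_on (boundary O `*` nbhdB D)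
    (fun q : 'rV[R]_N * 'rV[R]_NB => gam D q.1 q.2);
  gam_unit : forall x b, boundary O x -> B b -> enorm (gam D x b) = 1;
  gam_oblique : forall x b, boundary O x -> B b ->
    0 < dot (normal D x) (gam D x b);
  radius_gt0 : 0 < radius D;
  delta_gt0 : 0 < delta D;
  projP : forall x b, collar x -> B b ->
    [/\ boundary O (proj_pt D x b),
        `|proj_dist D x b| < delta D,
        x = proj_pt D x b + proj_dist D x b *: gam D (proj_pt D x b) b &
        forall (y : 'rV[R]_N) (s : R), boundary O y -> `|s| < delta D ->
          x = y + s *: gam D y b ->
          y = proj_pt D x b /\ s = proj_dist D x b];
  proj_pt_C1 : C1_on (collar `*` B)
    (fun q : 'rV[R]_N * 'rV[R]_NB => proj_pt D q.1 q.2);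
  proj_dist_C1 : C1_on (collar `*` B)
    (fun q : 'rV[R]_N * 'rV[R]_NB => proj_dist D q.1 q.2)
}.

Definition Hop (t : R) (x p : 'rV[R]_N) (M : 'M[R]_N) (z : R)
    (a : 'rV[R]_NA) : R :=
  - (2^-1 * \tr (sigma D t x a *m (sigma D t x a)^T *m M))
  - dot (mu D t x a) p + rate_r D t x a * z - cost_f D t x a.

Definition Lop (t : R) (x p : 'rV[R]_N) (z : R) (b : 'rV[R]_NB) : R :=
  dot (gam D x b) p + rate_k D t x b * z - cost_g D t x b.

Definition Rop (t : R) (x p : 'rV[R]_N) (z : R) (b : 'rV[R]_NB) : R :=
  2^-1 * rate_k D t x b ^+ 2 * z
  - 2^-1 * rate_k D t x b * cost_g D t x b
  + 2^-1 * rate_k D t x b * dot (gam D x b) p.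

(* A_{n,i}^a[phi] at t = t_n, x = x_i. *)
Definition Aop (phi : R * 'rV[R]_N -> R) (t : R) (x : 'rV[R]_N)
    (a : 'rV[R]_NA) : R :=
  - derive1 (fun s : R => phi (s, x)) t
  + Hop t x (grad (fun y => phi (t, y)) x) (hess (fun y => phi (t, y)) x)
        (phi (t, x)) a.

(* An admissible test function: C^3 on the neighbourhood W of
   [0,T] x closure O, with bounded derivatives of orders 1 to 3. *)
Definition test_function (W : set (R * 'rV[R]_N)) (phi : R * 'rV[R]_N -> R) :
    Prop :=
  [/\ open W, closedQ `<=` W, Ck 3 W phi &
      forall s : seq (R * 'rV[R]_N)%type, (1 <= size s <= 3)%N ->
        exists K : R, forall q, W q -> `|iter_derive s phi q| <= K].

End Data.

(* A mesh: vertices x_i, simplices given by their vertex sets, the curved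
   element of the exact triangulation attached to each simplex, the map p_h and
   the nodal basis.  Only the values of mesh_map on closure O and of nodal on
   the closed polyhedron matter. *)
Record mesh (R : realType) (N : nat) := Mesh {
  nverts : nat;
  vert : 'I_nverts -> 'rV[R]_N;
  elts : {set {set 'I_nverts}};
  curved : {set 'I_nverts} -> set 'rV[R]_N;
  mesh_map : 'rV[R]_N -> 'rV[R]_N;
  nodal : 'I_nverts -> 'rV[R]_N -> R
}.

Section Mesh.
Context {R : realType} {N : nat}.
Variables (O : set 'rV[R]_N) (M : mesh R N).

Definition simplex (S : {set 'I_(nverts M)}) : set 'rV[R]_N :=
  [set x | exists w : 'I_(nverts M) -> R,
     [/\ forall i, 0 <= w i, forall i, i \notin S -> w i = 0,
         \sum_i w i = 1 & x = \sum_i w i *: vert i]].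

Definition affinely_independent (S : {set 'I_(nverts M)}) : Prop :=
  forall w : 'I_(nverts M) -> R,
    (forall i, i \notin S -> w i = 0) -> \sum_i w i = 0 ->
    \sum_i w i *: vert i = 0 -> forall i, w i = 0.

Definition polyhedron : set 'rV[R]_N :=
  [set x | exists2 S, S \in elts M & simplex S x].

(* The conforming simplicial triangulation, of mesh size h. *)
Record triangulation (h : R) : Prop := Triangulation {
  vert_inj : injective (@vert R N M);
  vert_closure : forall i : 'I_(nverts M), closure O (vert i);
  vert_used : forall i : 'I_(nverts M), exists2 S, S \in elts M & i \in S;
  elts_card : forall S, S \in elts M -> #|S| = N.+1;
  elts_indep : forall S, S \in elts M -> affinely_independent S;
  elts_conform : forall S S', S \in elts M -> S' \in elts M ->
    simplex S `&` simplex S' = simplex (S :&: S');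
  size_ub : forall S, S \in elts M -> ediam (simplex S) <= h;
  size_attained : exists2 S, S \in elts M & ediam (simplex S) = h
}.

(* The exact triangulation of closure O: p_h maps each curved element
   homeomorphically onto its simplex (continuity of the inverse is automatic by
   compactness), the curved elements meet along the corresponding curved faces,
   and only elements touching the boundary of the polyhedron may be curved. *)
Record exact_triangulation : Prop := ExactTriangulation {
  curved_compact : forall S, S \in elts M -> compact (curved S);
  curved_cover : closure O =
    [set x | exists2 S, S \in elts M & curved S x];
  curved_vert : forall S i, S \in elts M -> i \in S -> curved S (vert i);
  curved_conform : forall S S', S \in elts M -> S' \in elts M ->
    curved S `&` curved S' = curved S `&` (mesh_map M @^-1` simplex (S :&: S'));
  curved_straight : forall S, S \in elts M ->
    simplex S `<=` interior polyhedron -> curved S = simplex S;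
  map_image : forall S, S \in elts M -> mesh_map M @` curved S = simplex S;
  map_inj : forall S, S \in elts M -> {in curved S &, injective (mesh_map M)};
  map_continuous : {within closure O, continuous (mesh_map M)};
  map_vert : forall i : 'I_(nverts M), mesh_map M (vert i) = vert i
}.

(* These properties determine nodal j on the polyhedron. *)
Record nodal_basis : Prop := NodalBasis {
  nodal_continuous : forall j : 'I_(nverts M),
    {within polyhedron, continuous (nodal j)};
  nodal_affine : forall (j : 'I_(nverts M)) S, S \in elts M ->
    exists (c : 'rV[R]_N) (e : R),
      forall x, simplex S x -> nodal j x = dot c x + e;
  nodal_vert : forall i j : 'I_(nverts M), nodal j (vert i) = (i == j)%:R
}.

Definition interp (V : 'I_(nverts M) -> R) (x : 'rV[R]_N) : R :=
  \sum_j nodal j (mesh_map M x) * V j.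

End Mesh.

(* Hs is the set of mesh parameters and Mh h the mesh of parameter h. *)
Record mesh_family (R : realType) (N : nat) (O : set 'rV[R]_N) (Hs : set R)
    (Mh : R -> mesh R N) : Prop := MeshFamily {
  family_gt0 : forall h, Hs h -> 0 < h;
  family_triangulation : forall h, Hs h -> triangulation O (Mh h) h;
  family_exact : forall h, Hs h -> exact_triangulation O (Mh h);
  family_nodal : forall h, Hs h -> nodal_basis (Mh h);
  (* shape regularity: diameter bounded by a multiple of the inradius *)
  family_regular : exists kappa : R, forall h, Hs h ->
    forall S, S \in elts (Mh h) ->
    exists (c : 'rV[R]_N) (rad : R),
      [/\ 0 < rad, [set y | enorm (y - c) <= rad] `<=` simplex S &
          ediam (simplex S) <= kappa * rad];
  family_interp : exists CI : R, forall h, Hs h ->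
    forall v : 'rV[R]_N -> R, Ck_closure 2 O v ->
    forall x, closure O x ->
      `|interp (fun i : 'I_(nverts (Mh h)) => v (vert i)) x - v x|
        <= CI * Ck_norm 2 O v * h ^+ 2
}.

Section Scheme.
Context {R : realType} {N Np NA NB : nat}.
Variable D : control_data R N Np NA NB.

(* The branches p = 1, ..., 2^Np are indexed by {ffun 'I_Np -> bool}; sign_vec
   is a bijection onto {-1, 1}^Np. *)
Definition sign_vec (p : {ffun 'I_Np -> bool}) : 'rV[R]_Np :=
  \row_j (-1) ^+ (p j : nat).

Section Branch.
Variables (dt t : R) (x : 'rV[R]_N) (a : 'rV[R]_NA) (b : 'rV[R]_NB).
Variable p : {ffun 'I_Np -> bool}.

Definition Xstar : 'rV[R]_N :=
  x + dt *: mu D t x a + Num.sqrt dt *: (sign_vec p *m (sigma D t x a)^T).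

Definition exiting : bool := Xstar \notin closure (dom D).

Definition xb : 'rV[R]_N := proj_pt D Xstar b.

Definition dtil : R := if exiting then 2 * proj_dist D Xstar b else 0.

Definition ktil : R := if exiting then rate_k D t xb b else 0.

Definition gtil : R := if exiting then cost_g D t xb b else 0.

Definition Xtil : 'rV[R]_N :=
  if exiting then Xstar - dtil *: gam D xb b else Xstar.

Definition Ltil (phi : R * 'rV[R]_N -> R) : R :=
  if exiting
  then Lop D t xb (grad (fun y => phi (t, y)) xb) (phi (t, xb)) b
  else 0.

Definition Rtil (phi : R * 'rV[R]_N -> R) : R :=
  if exiting
  then Rop D t xb (grad (fun y => phi (t, y)) xb) (phi (t, xb)) b
  else 0.

End Branch.

Definition branch_mean (F : {ffun 'I_Np -> bool} -> R) : R :=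
  (2 ^+ Np)^-1 * \sum_p F p.

Variable M : mesh R N.

Definition Sint (dt t : R) (i : 'I_(nverts M)) (V : 'I_(nverts M) -> R)
    (a : 'rV[R]_NA) (b : 'rV[R]_NB) : R :=
  let x := vert i in
  (1 + rate_r D t x a * dt)^-1 *
    branch_mean (fun p =>
      let d := dtil dt t x a b p in
      let k := ktil dt t x a b p in
      let g := gtil dt t x a b p in
      expR (- (k * d)) * interp V (Xtil dt t x a b p)
      + d * expR (- (k * d / 2)) * g)
  + dt * cost_f D t x a.

Definition Sint_inf (dt t : R) (i : 'I_(nverts M)) (V : 'I_(nverts M) -> R) :
    R :=
  inf [set Sint dt t i V a b | a in ctrlA D & b in ctrlB D].

Definition Sbd (ell t : R) (i : 'I_(nverts M)) (V : 'I_(nverts M) -> R) : R :=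
  let x := vert i in
  inf [set (interp V (x - ell *: gam D x b) + ell * cost_g D t x b)
           / (1 + ell * rate_k D t x b) | b in ctrlB D].

End Scheme.

(* Main.v *)
Require Import Defs.
From mathcomp Require Import all_boot all_order all_algebra.
From mathcomp Require Import all_classical all_reals all_analysis.
From mathcomp Require Import ring lra.
Import Order.TTheory GRing.Theory Num.Theory.
Import numFieldNormedType.Exports.
Local Open Scope classical_set_scope.
Local Open Scope ring_scope.

(** Consistency rests on three facts.

    First, averaging over the signs is a quadrature of degree three.  With
    v_p = (dt, X*_p - x), a third-order Taylor expansion of phi at (t, x) in
    space-time leaves a remainder of size |v_p|^3 = O(dt^(3/2)).  The signs have
    mean zero and covariance the identity, so in the mean over p the noise
    disappears at first order and produces the trace of sigma sigma^T D^2 phi at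
    second order: the mean of phi(t + dt, X*_p) is phi + dt * gen + O(dt^(3/2)),
    where gen is the generator of the diffusion (mean_expansion).

    Secondly, a reflected branch is accurate to third order in d.  The exiting
    point and its reflection are y + (d/2) gamma and y - (d/2) gamma for one
    boundary point y, so the even Taylor terms of phi at y cancel in their
    difference, which is d gamma . D phi + O(d^3) (phi_symmetric_difference).
    Expanding the exponential weights to second order then yields the operators
    L and R as the coefficients of -d and d^2 (reflection_expansion).

    Thirdly, d = O(dt^(1/2)) and the reflected point lies in the domain, both
    uniformly in the data (exit_geometry).  The segment from x to an exiting X*
    meets the boundary at some z; the oblique distance vanishes at z and is
    Lipschitz near the boundary, so it is at most a multiple of |X* - z|.  That
    d is positive and that y - (d/2) gamma is inside follow from the local
    defining functions, which increase strictly along gamma (oblique_ray).  All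
    constants are uniform by compactness (compact_uniform_scale).

    Discounting by 1 / (1 + r dt) adds the zeroth-order term.  The interpolation
    error is O(h^2) and is not amplified, the weights and the discount factor
    being at most one.  As every remainder is uniform in the controls, it passes
    through the infimum (inf_sup_perturbation).  At a boundary node the same
    argument with a first-order expansion along gamma gives O(l_h^2 + h^2), that
    is, O(h^2).

    Class C^k is given by iterated directional derivatives, so the calculus
    starts by showing that these are multilinear in the directions
    (iter_derive_multilinear); gradients, Hessians and homogeneous bounds on the
    derivatives all come from that. *)

Set Implicit Arguments.
Unset Strict Implicit.
Unset Printing Implicit Defensive.

(** * Directional derivatives of C^k functions *)

Section Directional.
Context {R : realType} {V : normedModType R}.
Implicit Types (G : V -> R) (x v w : V) (U : set V).

Lemma is_derive_line G x v (s : R) : derivable G (x + s *: v) v ->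
  is_derive s 1 (fun r : R => G (x + r *: v)) ('D_v G (x + s *: v)).
Proof.
move=> dG.
have E : (fun h : R => h^-1 *: (((fun r : R => G (x + r *: v)) \o shift s)
            (h *: 1) - G (x + s *: v))) =
         (fun h : R => h^-1 *: ((G \o shift (x + s *: v)) (h *: v)
            - G (x + s *: v))).
  apply/funext => h /=; congr (_ *: (G _ - _)).
  by rewrite [h%:A]mulr1 scalerDl addrCA.
by split; rewrite /derivable /derive E.
Qed.

Lemma mvt_dir G x v :
  (forall s : R, 0 <= s <= 1 -> derivable G (x + s *: v) v) ->
  exists2 s : R, 0 <= s <= 1 & G (x + v) - G x = 'D_v G (x + s *: v).
Proof.
move=> dG.
have d (s : R) : 0 <= s <= 1 -> is_derive s 1 (fun r : R => G (x + r *: v))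
    ('D_v G (x + s *: v)) by move=> /dG; exact: is_derive_line.
have [||s s01] := @MVT_segment _ (fun r : R => G (x + r *: v))
    (fun s : R => 'D_v G (x + s *: v)) 0 1 ler01.
- by move=> s; rewrite in_itv /= => /andP[s0 s1]; apply: d; rewrite !ltW.
- apply: derivable_within_continuous => s; rewrite in_itv /= => s01.
  by have [] := d _ s01.
rewrite scale1r scale0r addr0 subr0 mulr1 => ->.
by exists s; move: s01; rewrite in_itv.
Qed.

Lemma Ck_le {W : normedModType R} k k' U (f : V -> W) :
  (k' <= k)%N -> Ck k U f -> Ck k' U f.
Proof.
move=> kk' Cf s x Ux sk; have [Cc Cd] := Cf s x Ux (leq_trans sk kk').
by split => // sk'; apply: Cd; exact: leq_trans sk' kk'.
Qed.

(** Lets the first-order statements below be applied to derivatives of any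
    order. *)
Lemma Ck_iter {W : normedModType R} k U (f : V -> W) (s : seq V) :
  Ck k U f -> (size s < k)%N -> Ck 1 U (iter_derive s f).
Proof.
move=> Cf sk t x Ux t1.
have E r : iter_derive r (iter_derive s f) = iter_derive (r ++ s) f.
  by rewrite /iter_derive foldr_cat.
rewrite E; have [|Cc Cd] := Cf (t ++ s) x Ux.
  by rewrite size_cat (leq_trans _ sk) // -addn1 addnC leq_add2l.
split => // t0 v; apply: Cd; rewrite size_cat.
by move: t0; rewrite ltnS leqn0 => /eqP->.
Qed.

Lemma Ck1_derivable U G x v : Ck 1 U G -> U x -> derivable G x v.
Proof. by move=> CG Ux; have [_] := CG [::] x Ux isT; apply. Qed.

Lemma Ck1_continuous_derive U G x v : Ck 1 U G -> U x ->
  {for x, continuous ('D_v G)}.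
Proof. by move=> CG Ux; have [] := CG [:: v] x Ux isT. Qed.

Lemma deriveZ_dir G x v (c : R) : derivable G x v ->
  'D_(c *: v) G x = c * 'D_v G x.
Proof.
move=> dG.
have [] : is_derive (0 : R) (1 : R) (fun r : R => G (x + r *: v)) ('D_v G x).
  by have := @is_derive_line G x v 0; rewrite scale0r addr0; apply.
move=> d1 d2.
have -> : 'D_(c *: v) G x = 'D_(c : R) (fun r : R => G (x + r *: v)) (0 : R).
  rewrite /derive; congr (lim (_ @ 0^')); apply/funext => h /=.
  by rewrite scale0r addr0 addr0 scalerA [x + _]addrC.
have df : differentiable (fun r : R => G (x + r *: v)) (0 : R).
  exact/derivable1_diffP.
rewrite deriveE // -d2 (deriveE _ df).
by rewrite -{1}[c]mulr1 -[c * 1]/(c *: 1) linearZ.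
Qed.

(** Continuity of the directional derivatives replaces differentiability: the
    increment along w is taken from the moving base point x + h v, where the mean
    value theorem expresses it by a value of D_w G close to that at x. *)
Lemma deriveD_dir U G x v w : open U -> Ck 1 U G -> U x ->
  'D_(v + w) G x = 'D_v G x + 'D_w G x.
Proof.
move=> oU CG Ux.
have dv : (fun h : R => h^-1 *: ((G \o shift x) (h *: v) - G x)) @ 0^'
    --> 'D_v G x by exact: (Ck1_derivable CG).
suff dw : (fun h : R => h^-1 *: ((G \o shift x) (h *: (v + w))
    - (G \o shift x) (h *: v))) @ 0^' --> 'D_w G x.
  apply: (@cvg_lim _ (@Rhausdorff R)).
  have -> : (fun h : R => h^-1 *: ((G \o shift x) (h *: (v + w)) - G x)) =
    (fun h : R => h^-1 *: ((G \o shift x) (h *: v) - G x) +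
      h^-1 *: ((G \o shift x) (h *: (v + w)) - (G \o shift x) (h *: v))).
    apply/funext => h; rewrite -scalerDr; congr (_ *: _).
    by rewrite [RHS]addrC addrA subrK.
  exact: cvgD dv dw.
apply/cvgrPdist_le => e e0.
have cw := Ck1_continuous_derive (v := w) CG Ux.
have [d /= d0 dP] : exists2 d : R, 0 < d & forall y, `|x - y| < d ->
    U y /\ `|'D_w G x - 'D_w G y| <= e.
  have /nbhs_ballP[d /= d0 dP] : nbhs x
      [set y | U y /\ `|'D_w G x - 'D_w G y| <= e].
    apply: filterI; first exact: (open_nbhs_nbhs (conj oU Ux)).
    by move/cvgrPdist_le : cw; apply.
  by exists d => // y xy; apply: dP; rewrite -ball_normE.
have c0 : 0 < `|v| + `|w| + 1 by rewrite ltr_wpDl // addr_ge0.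
near=> h.
have hd : `|h| * (`|v| + `|w|) < d.
  apply: (@le_lt_trans _ _ (`|h| * (`|v| + `|w| + 1))).
    by rewrite ler_wpM2l // lerDl.
  rewrite -ltr_pdivlMr //; near: h.
  by apply: dnbhs0_lt; rewrite divr_gt0.
have h0 : h != 0 by near: h; exact: nbhs_dnbhs_neq.
have near_pt (s : R) : 0 <= s <= 1 -> `|x - (x + h *: v + s *: (h *: w))| < d.
  move=> /andP[s0 s1]; apply: le_lt_trans hd.
  rewrite -addrA opprD addrA subrr sub0r normrN.
  rewrite (le_trans (ler_normD _ _)) // mulrDr !normrZ lerD2l.
  by rewrite mulrA ler_wpM2r // ler_piMl // ger0_norm.
have [s s01 /= E] : exists2 s : R, 0 <= s <= 1 &
    G (x + h *: v + h *: w) - G (x + h *: v)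
    = 'D_(h *: w) G (x + h *: v + s *: (h *: w)).
  apply: mvt_dir => s /near_pt /dP [Us _]; exact: Ck1_derivable CG Us.
have [Us Ds] := dP _ (near_pt _ s01).
rewrite /= [h *: (v + w) + x]addrC [h *: v + x]addrC.
rewrite [h *: (v + w)]scalerDr addrA E.
rewrite deriveZ_dir; last first.
  exact: Ck1_derivable CG Us.
by rewrite -[_ *: _]/(_ * _) mulKf.
Unshelve. all: by end_near. Qed.

Lemma derive_sum_dir U G x (J : finType) (c : J -> R) (w : J -> V) :
  open U -> Ck 1 U G -> U x ->
  'D_(\sum_j c j *: w j) G x = \sum_j c j * 'D_(w j) G x.
Proof.
move=> oU CG Ux.
elim/big_rec2: _ => [|j y1 y2 _ <-]; first exact: derive0.
by rewrite (deriveD_dir _ _ oU CG Ux) deriveZ_dir //; exact: Ck1_derivable CG Ux.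
Qed.

(** An inner direction can be expanded because the identity holds on the whole
    open set U, and derivatives only see G near the point. *)
Lemma iter_derive_multilinear k U G (s t : seq V) x
    (J : finType) (c : J -> R) (w : J -> V) :
  open U -> Ck k U G -> U x -> (size t + size s < k)%N ->
  iter_derive (t ++ (\sum_j c j *: w j) :: s) G x =
  \sum_j c j * iter_derive (t ++ w j :: s) G x.
Proof.
move=> oU CG; elim: t x => [|v t IH] x Ux sk /=.
  by apply: (@derive_sum_dir U) => //; apply: Ck_iter CG sk.
have tk : (size t + size s < k)%N by apply: ltn_trans sk; rewrite addSn.
rewrite (@near_eq_derive _ _ _ _
  (\sum_j (c j \*: iter_derive (t ++ w j :: s) G))); last first.
  near=> y; rewrite IH //; last by near: y; exact: (open_nbhs_nbhs (conj oU Ux)).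
  by rewrite fct_sumE.
have D j : derivable (iter_derive (t ++ w j :: s) G) x v.
  apply: (@Ck1_derivable U) => //; apply: Ck_iter CG _.
  by rewrite size_cat /= addnS.
transitivity (\sum_j 'D_v (c j \*: iter_derive (t ++ w j :: s) G) x).
  suff [] : is_derive x v (\sum_j (c j \*: iter_derive (t ++ w j :: s) G))
    (\sum_j 'D_v (c j \*: iter_derive (t ++ w j :: s) G) x) by [].
  elim/big_ind2: _ => [|y1 y2 z1 z2 d1 d2|j _].
  - exact: is_derive_cst.
  - exact: is_deriveD.
  - by apply: derivableP; exact: derivableZ.
by apply: eq_bigr => j _; rewrite deriveZ.
Unshelve. all: by end_near. Qed.

Lemma iter_derive_scale k U G (s t : seq V) x c v :
  open U -> Ck k U G -> U x -> (size t + size s < k)%N ->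
  iter_derive (t ++ (c *: v) :: s) G x = c * iter_derive (t ++ v :: s) G x.
Proof.
move=> oU CG Ux sk.
have := @iter_derive_multilinear k U G s t x 'I_1 (fun=> c) (fun=> v) oU CG Ux sk.
by rewrite !big_ord1.
Qed.

Lemma iter_derive_lin2 k U G (s t : seq V) x c d v w :
  open U -> Ck k U G -> U x -> (size t + size s < k)%N ->
  iter_derive (t ++ (c *: v + d *: w) :: s) G x =
  c * iter_derive (t ++ v :: s) G x + d * iter_derive (t ++ w :: s) G x.
Proof.
move=> oU CG Ux sk.
have := @iter_derive_multilinear k U G s t x bool
  (fun b => if b then c else d) (fun b => if b then v else w) oU CG Ux sk.
by rewrite !big_bool.
Qed.

End Directional.

(** * Taylor expansions along a segment *)

Section Taylor1D.
Context {R : realType}.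
Implicit Types (h dh g : R -> R) (K s : R).

Lemma incr_le h dh K :
  (forall s, 0 <= s <= 1 -> is_derive s 1 h (dh s)) ->
  (forall s, 0 <= s <= 1 -> `|dh s| <= K) ->
  forall s, 0 <= s <= 1 -> `|h s - h 0| <= K.
Proof.
move=> d b s /andP[s0 s1].
have sub r : r \in `[0, s] -> 0 <= r <= 1.
  by rewrite in_itv /= => /andP[-> /le_trans ->].
have [|| r rs ->] := @MVT_segment _ h dh 0 s s0.
- by move=> r rs; apply/d/sub; move: rs; rewrite !in_itv /= => /andP[/ltW-> /ltW->].
- by apply: derivable_within_continuous => r /sub /d [].
rewrite subr0 normrM (ger0_norm s0) (le_trans _ (b r (sub _ rs))) //.
by rewrite ler_piMr.
Qed.

(** Only the order of the remainder matters below, so the mean value inequality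
    is iterated on the successive Taylor remainders instead of seeking the sharp
    constant 1/2; likewise for 1/6 in the next lemma. *)
Lemma taylor2_1d g0 g1 g2 K :
  (forall s, 0 <= s <= 1 -> is_derive s 1 g0 (g1 s)) ->
  (forall s, 0 <= s <= 1 -> is_derive s 1 g1 (g2 s)) ->
  (forall s, 0 <= s <= 1 -> `|g2 s| <= K) ->
  `|g0 1 - g0 0 - g1 0| <= K.
Proof.
move=> d0 d1 b2.
have b1 := incr_le d1 b2.
have dh s : 0 <= s <= 1 -> is_derive s 1 (fun r : R => g0 r - r * g1 0) (g1 s - g1 0).
  move=> /d0 D.
  have D1 : is_derive s 1 (fun r : R => r * g1 0) (g1 0).
    have -> : (fun r : R => r * g1 0) = g1 0 \*: (@id R).
      by apply/funext => r; rewrite /GRing.scale /= mulrC.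
    by apply: is_derive_eq; rewrite [LHS]mulr1.
  exact: is_deriveB.
have := incr_le dh b1 (s := 1); rewrite ler01 lexx => /(_ isT).
by rewrite mul1r mul0r subr0 addrAC.
Qed.

Lemma taylor3_1d g0 g1 g2 g3 K :
  (forall s, 0 <= s <= 1 -> is_derive s 1 g0 (g1 s)) ->
  (forall s, 0 <= s <= 1 -> is_derive s 1 g1 (g2 s)) ->
  (forall s, 0 <= s <= 1 -> is_derive s 1 g2 (g3 s)) ->
  (forall s, 0 <= s <= 1 -> `|g3 s| <= K) ->
  `|g0 1 - g0 0 - g1 0 - 2^-1 * g2 0| <= K.
Proof.
move=> d0 d1 d2 b3.
have b2 := incr_le d2 b3.
have lin s c : is_derive s 1 (fun r : R => r * c) c.
  have -> : (fun r : R => r * c) = c \*: (@id R).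
    by apply/funext => r; rewrite /GRing.scale /= mulrC.
  by apply: is_derive_eq; rewrite [LHS]mulr1.
have dh1 s : 0 <= s <= 1 ->
    is_derive s 1 (fun r : R => g1 r - r * g2 0) (g2 s - g2 0).
  by move=> /d1 D; have D1 := lin s (g2 0); exact: is_deriveB.
have b1 := incr_le dh1 b2.
have quad s c : is_derive s 1 (fun r : R => 2^-1 * (r ^+ 2 * c)) (s * c).
  have -> : (fun r : R => 2^-1 * (r ^+ 2 * c)) = (2^-1 * c) \*: ((@id R) ^+ 2).
    apply/funext => r; rewrite [RHS]/(2^-1 * c * ((@id R) ^+ 2) r) exprfctE /=.
    by rewrite mulrA mulrAC.
  apply: is_derive_eq; rewrite /= /GRing.scale /=.
  by field.
have dh0 s : 0 <= s <= 1 ->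
    is_derive s 1 (fun r : R => g0 r - r * g1 0 - 2^-1 * (r ^+ 2 * g2 0))
      (g1 s - g1 0 - s * g2 0).
  move=> /d0 D; have D1 := lin s (g1 0); have D2 := quad s (g2 0).
  by apply: is_deriveB; exact: is_deriveB.
have := @incr_le _ _ K dh0 _ 1; rewrite ler01 lexx => /(_ _ isT).
rewrite !mul1r !mul0r expr0n /= mul0r mulr0 !subr0 expr1n mul1r.
set u := _ - _; move=> H; have {H} : `|u| <= K.
  apply: H => s s01; move: (b1 s s01); rewrite mul0r subr0.
  by rewrite addrAC.
by congr (`| _ | <= K); rewrite /u; ring.
Qed.

End Taylor1D.

Section Taylor.
Context {R : realType} {V : normedModType R}.
Variables (U : set V) (G : V -> R).

Lemma taylor1 x v K : Ck 1 U G -> (forall s : R, 0 <= s <= 1 -> U (x + s *: v)) ->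
  (forall q, U q -> `|'D_v G q| <= K) -> `|G (x + v) - G x| <= K.
Proof.
move=> CG seg b.
have [s s01|s s01 ->] := @mvt_dir _ _ G x v.
  by apply: Ck1_derivable CG _; exact: seg.
exact/b/seg.
Qed.

Let line k (s : seq V) x v (r : R) : Ck k U G -> (size s < k)%N ->
  U (x + r *: v) ->
  is_derive r 1 (fun r : R => iter_derive s G (x + r *: v))
    (iter_derive (v :: s) G (x + r *: v)).
Proof.
move=> CG sk Ur; apply: is_derive_line.
by apply: (@Ck1_derivable _ _ U) => //; exact: Ck_iter CG sk.
Qed.

Lemma taylor2 x v K : Ck 2 U G -> (forall s : R, 0 <= s <= 1 -> U (x + s *: v)) ->
  (forall q, U q -> `|'D_v ('D_v G) q| <= K) ->
  `|G (x + v) - G x - 'D_v G x| <= K.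
Proof.
move=> CG seg b.
have := @taylor2_1d _ (fun r : R => iter_derive [::] G (x + r *: v))
  (fun r : R => iter_derive [:: v] G (x + r *: v))
  (fun r : R => iter_derive [:: v; v] G (x + r *: v)) K.
rewrite /= scale1r scale0r addr0; apply.
- by move=> s /seg Us; exact: (@line 2 [::]).
- by move=> s /seg Us; exact: (@line 2 [:: v]).
- by move=> s /seg; exact: b.
Qed.

Lemma taylor3 x v K : Ck 3 U G -> (forall s : R, 0 <= s <= 1 -> U (x + s *: v)) ->
  (forall q, U q -> `|'D_v ('D_v ('D_v G)) q| <= K) ->
  `|G (x + v) - G x - 'D_v G x - 2^-1 * 'D_v ('D_v G) x| <= K.
Proof.
move=> CG seg b.
have := @taylor3_1d _ (fun r : R => iter_derive [::] G (x + r *: v))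
  (fun r : R => iter_derive [:: v] G (x + r *: v))
  (fun r : R => iter_derive [:: v; v] G (x + r *: v))
  (fun r : R => iter_derive [:: v; v; v] G (x + r *: v)) K.
rewrite /= scale1r scale0r addr0; apply.
- by move=> s /seg Us; exact: (@line 3 [::]).
- by move=> s /seg Us; exact: (@line 3 [:: v]).
- by move=> s /seg Us; exact: (@line 3 [:: v; v]).
- by move=> s /seg; exact: b.
Qed.

End Taylor.

Section DerivBound.
Context {R : realType} {V : normedModType R} (J : finType).
Variables (E : J -> V) (c : V -> J -> R).
Hypothesis cE : forall v, v = \sum_j c v j *: E j.
Hypothesis cb : forall v j, `|c v j| <= `|v|.

(** Multilinearity turns bounds on the finitely many derivatives along the
    vectors E j into one that is homogeneous in the directions.  The induction
    replaces the directions by vectors E j one at a time, the outermost first;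
    l records those already replaced. *)
Lemma iter_derive_bound k (U : set V) (G : V -> R) : open U -> Ck k U G ->
  (forall s : seq V, (1 <= size s <= k)%N ->
     exists K : R, forall q, U q -> `|iter_derive s G q| <= K) ->
  forall m, (1 <= m <= k)%N -> exists2 K : R, 0 <= K & forall s q, size s = m ->
    U q -> `|iter_derive s G q| <= K * \prod_(v <- s) `|v|.
Proof.
move=> oU CG b.
suff H m l : (1 <= m + size l <= k)%N -> exists2 K : R, 0 <= K &
    forall s q, size s = m -> U q ->
    `|iter_derive (map E l ++ s) G q| <= K * \prod_(v <- s) `|v|.
  by move=> m mk; have [|K K0 HK] := H m [::]; [rewrite addn0|exists K].
elim: m l => [|m IH] l ml.
  have [|K HK] := b (map E l); first by rewrite size_map.
  exists `|K| => // -[] // q _ Uq; rewrite cats0 big_nil mulr1.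
  by rewrite (le_trans (HK q Uq)) // ler_norm.
have /choice[K HK] : forall j, exists K : R, 0 <= K /\
    forall s q, size s = m -> U q ->
    `|iter_derive (map E (rcons l j) ++ s) G q| <= K * \prod_(v <- s) `|v|.
  move=> j; have [|K K0 HK] := IH (rcons l j); last by exists K.
  by rewrite size_rcons addnS -addSn.
exists (\sum_j K j); first by apply: sumr_ge0 => j _; have [] := HK j.
move=> [//|v s] q [sm] Uq; rewrite {1}[v]cE.
rewrite (@iter_derive_multilinear _ _ k U) //; last first.
  by rewrite size_map sm; move: ml => /andP[_]; rewrite addSn addnC.
rewrite (le_trans (ler_norm_sum _ _ _)) // big_cons mulr_suml ler_sum // => j _.
have [K0 HKj] := HK j.
rewrite normrM mulrCA ler_pM //.
by have := HKj s q sm Uq; rewrite map_rcons cat_rcons.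
Qed.

End DerivBound.

(** * Norms and compactness *)

Section Norms.
Context {R : realType}.

Lemma mx_entry_le m n (M : 'M[R]_(m, n)) i j : `|M i j| <= `|M|.
Proof.
rewrite [leRHS]/Num.Def.normr /= mx_normrE; apply/bigmax_geP; right => /=.
by exists (i, j).
Qed.

Lemma mx_norm_le m n (M : 'M[R]_(m, n)) K : 0 <= K ->
  (forall i j, `|M i j| <= K) -> `|M| <= K.
Proof.
move=> K0 H; rewrite [leLHS]/Num.Def.normr /= mx_normrE; apply/bigmax_leP.
by split => // -[i j] _; exact: H.
Qed.

Lemma dot_ge0 n (u : 'rV[R]_n) : 0 <= dot u u.
Proof. by apply: sumr_ge0 => i _; rewrite -expr2 sqr_ge0. Qed.

Lemma normr_le_enorm n (u : 'rV[R]_n) : `|u| <= enorm u.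
Proof.
apply: mx_norm_le => [|i j]; first exact: sqrtr_ge0.
rewrite ord1 -sqrtr_sqr ler_sqrt; last exact: dot_ge0.
rewrite /dot (bigD1 j) //= -expr2 lerDl.
by apply: sumr_ge0 => k _; rewrite -expr2 sqr_ge0.
Qed.

Lemma enorm_le_normr n (u : 'rV[R]_n) : enorm u <= n%:R * `|u|.
Proof.
rewrite -[leRHS]ger0_norm ?mulr_ge0 // -sqrtr_sqr ler_sqrt ?sqr_ge0 //.
apply: (@le_trans _ _ (\sum_(i < n) `|u| ^+ 2)).
  apply: ler_sum => i _; rewrite -expr2 -real_normK ?num_real //.
  by rewrite lerXn2r ?nnegrE // mx_entry_le.
rewrite sumr_const card_ord -[`|u| ^+ 2 *+ n]mulr_natl exprMn ler_wpM2r ?sqr_ge0 //.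
by rewrite -natrX ler_nat; case: (n) => // k; rewrite -mulnn leq_pmulr.
Qed.

Lemma row_basis n (u : 'rV[R]_n) : u = \sum_j u 0 j *: basis_vec j.
Proof. exact: row_sum_delta. Qed.

Lemma pair_norm_le (V W : normedModType R) (a : V) (b : W) K :
  (`|(a, b)| <= K) = (`|a| <= K) && (`|b| <= K).
Proof. by rewrite prod_normE ge_max. Qed.

Lemma pair_dist_lt (V W : normedModType R) (a c : V) (b d : W) K :
  (`|(a, b) - (c, d)| < K) = (`|a - c| < K) && (`|b - d| < K).
Proof. by rewrite prod_normE gt_max. Qed.

Lemma derive_dot n (U : set 'rV[R]_n) (rho : 'rV[R]_n -> R) z v :
  open U -> Ck 1 U rho -> U z -> 'D_v rho z = dot (grad rho z) v.
Proof.
move=> oU Cr Uz; rewrite {1}(row_basis v) (derive_sum_dir _ _ oU Cr Uz).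
by apply: eq_bigr => j _; rewrite mxE mulrC.
Qed.

End Norms.

Section Compactness.
Context {R : realType}.

Lemma compact_bound (T : topologicalType) (W : normedModType R)
    (K : set T) (F : T -> W) : compact K -> {within K, continuous F} ->
  exists M : R, forall x, K x -> `|F x| <= M.
Proof.
move=> cK cF; have [M [_ HM]] := compact_bounded (continuous_compact cF cK).
by exists (M + 1) => x Kx; apply: (HM (M + 1)); [rewrite ltrDl|exists x].
Qed.

(** This is where all uniform constants of the geometry come from: finitely many
    of the neighbourhoods cover K, and the smallest of their scales serves. *)
Lemma compact_uniform_scale (T : topologicalType) (K : set T)
    (P : R -> T -> Prop) : compact K ->
  (forall (e e' : R) x, 0 < e' <= e -> P e x -> P e' x) ->
  (forall x, K x -> exists2 e : R, 0 < e & \forall y \near x, P e y) ->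
  exists2 e : R, 0 < e & forall x, K x -> P e x.
Proof.
move=> /compact_near_coveringP cK anti loc.
have H : \forall e \near (0 : R)^'+, K `<=` P e.
  apply: (cK R (0^'+) P _) => x /loc [e e0 Pe].
  exists (P e, [set e' | 0 < e' <= e]) => /=.
    split => //; near=> e'; apply/andP; split; near: e'.
      exact: nbhs_right_gt.
    exact: nbhs_right_le.
  by move=> [y e'] /= [Py /anti]; apply.
near (0 : R)^'+ => e; exists e => //.
by near: e.
Unshelve. all: by end_near. Qed.

Lemma boundary_compact n (O : set 'rV[R]_n) : bounded_set O ->
  compact (closure O) /\ compact (boundary O).
Proof.
move=> /ex_strict_bound_gt0[M M0 HM].
have cO : compact (closure O).
  apply: bounded_closed_compact; last exact: closed_closure.
  have sub : closure O `<=` closed_ball_ Num.Def.normr (0 : 'rV[R]_n) M.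
    rewrite -closed_ballE //; rewrite [X in _ `<=` X](closure_id _).1; last first.
      exact: closed_ball_closed.
    apply: closure_subset => x /HM /ltW xM.
    by rewrite closed_ballE //= /closed_ball_ /= sub0r normrN.
  exists M; split; first exact: num_real.
  move=> N MN x /sub; rewrite /closed_ball_ /= sub0r normrN => xM.
  exact: le_trans xM (ltW MN).
split => //; apply: (subclosed_compact _ cO); last by move=> x [].
by rewrite /boundary setDE; apply: closedI; [exact: closed_closure|];
  apply: open_closedC; exact: open_interior.
Qed.

(** The crossing point is the last one of the segment that lies in the closure:
    if it were in the open set O, slightly later points would be too. *)
Lemma segment_crosses_boundary n (O : set 'rV[R]_n) (x y : 'rV[R]_n) :
  open O -> O x -> ~ closure O y ->
  exists2 s : R, 0 <= s <= 1 & boundary O (x + s *: (y - x)).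
Proof.
move=> oO Ox Cy.
pose f (s : R) : 'rV[R]_n := x + s *: (y - x).
have cf : continuous f.
  move=> s; apply: cvgD; first exact: cvg_cst.
  by apply: cvgZr_tmp; exact: cvg_id.
pose A := `[0, 1]%classic `&` f @^-1` closure O.
have cA : compact A.
  apply: (subclosed_compact _ (@segment_compact _ 0 1)); last by move=> ? [].
  apply: closedI.
    exact: (compact_closed (@Rhausdorff R) (@segment_compact _ 0 1)).
  by apply: closed_comp => [s _|]; [exact: cf|exact: closed_closure].
have A0 : A !=set0.
  exists 0; split; rewrite /= ?in_itv /= ?lexx ?ler01 //.
  by rewrite /f scale0r addr0; exact: subset_closure.
have [|s sA max] := @compact_EVT_max _ R id A A0 cA.
  by apply: continuous_subspaceT => ?; exact: cvg_id.
move: sA; rewrite inE => -[/=]; rewrite in_itv /= => s01 cs.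
exists s => //; split => //; rewrite (interior_id _).1 // => Os.
have s1 : s < 1.
  rewrite lt_neqAle (andP s01).2 andbT; apply: contra_notN Cy => /eqP s1.
  by move: cs; rewrite /f s1 scale1r subrKC.
have nO : \forall r \near s, O (f r).
  by apply: (cf s); exact: (open_nbhs_nbhs (conj oO Os)).
have [r [sr r1 Or]] : exists r, [/\ s < r, r <= 1 & O (f r)].
  near s^'+ => r; exists r; split; near: r.
  - exact: nbhs_right_gt.
  - exact: nbhs_right_le.
  - by apply: cvg_within; exact: nO.
suff : r <= s by rewrite leNgt sr.
apply: (max r); rewrite inE; split; last exact: subset_closure.
by rewrite /= in_itv /= r1 andbT (le_trans _ (ltW sr)) // (andP s01).1.
Unshelve. all: by end_near. Qed.

End Compactness.

(** * Oblique rays and the oblique projection near the boundary *)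

Section Geometry.
Context {R : realType} {N Np NA NB : nat}.
Variables (D : control_data R N Np NA NB) (hD : standing D).

Local Notation O := (dom D).
Local Notation B := (ctrlB D).

Lemma gam_norm_le y b : boundary O y -> B b -> `|gam D y b| <= 1.
Proof. by move=> Oy Bb; rewrite -(gam_unit hD Oy Bb) normr_le_enorm. Qed.

Lemma closureE y : closure O y -> ~ O y -> boundary O y.
Proof. by move=> cy Oy; split=> //; rewrite (interior_id _).1 //; exact: dom_open. Qed.

(** Near the boundary the defining function increases strictly along gamma, so
    a short step backwards enters the domain and a short step forwards leaves
    its closure; compactness makes the step length uniform. *)
Lemma oblique_ray : exists2 s0 : R, 0 < s0 &
  forall y b (r : R), boundary O y -> B b -> 0 < r < s0 ->
    O (y - r *: gam D y b) /\ ~ closure O (y + r *: gam D y b).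
Proof.
pose P (e : R) (q : 'rV[R]_N * 'rV[R]_NB) := (boundary O `*` B) q ->
  forall r, 0 < r < e -> O (q.1 - r *: gam D q.1 q.2) /\
     ~ closure O (q.1 + r *: gam D q.1 q.2).
have [|e e' q /andP[_ ee'] H Kq r /andP[r0 re']||s0 s00 H] :=
  @compact_uniform_scale R _ (boundary O `*` B) P.
- apply: compact_setX; last exact: ctrlB_compact hD.
  by have [] := boundary_compact (dom_bounded hD).
- by apply: H => //; rewrite r0 (lt_le_trans re').
- move=> [y0 b0] [/= Oy0 Bb0].
  have [U [rho [Uy0 [oU Crho grad0 Oin Obd] nE]]] := Defs.normalP hD Oy0.
  have [Z [G [oZ Zq0 CG GE]]] : exists Z G,
      [/\ open Z, Z (y0, b0), Ck 1 Z G & forall y, Z y ->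
        (boundary O `*` nbhdB D) y -> G y = gam D y.1 y.2].
    by apply: (gam_C1 hD (z := (y0, b0))); split => //=; exact: (nbhdB_sub hD).
  have cG : {for (y0, b0), continuous G} by have [] := CG [::] _ Zq0 isT.
  have C1rho : Ck 1 U rho by exact: Ck_le Crho.
  (* The point z at which the gradient is taken is decoupled from the base point
     of the ray, so that positivity holds along the whole ray. *)
  pose F (w : 'rV[R]_N * ('rV[R]_N * 'rV[R]_NB)) := dot (grad rho w.1) (G w.2).
  have F0 : 0 < F (y0, (y0, b0)).
    have := gam_oblique hD Oy0 Bb0.
    rewrite nE /F /= GE //; last by split => //=; exact: (nbhdB_sub hD).
    have -> : dot ((enorm (grad rho y0))^-1 *: grad rho y0) (gam D y0 b0) =
        (enorm (grad rho y0))^-1 * dot (grad rho y0) (gam D y0 b0).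
      by rewrite /dot mulr_sumr; apply: eq_bigr => i _; rewrite mxE mulrA.
    apply: contraTT; rewrite -!leNgt => ?.
    by rewrite mulr_ge0_le0 // invr_ge0 sqrtr_ge0.
  have cF : {for (y0, (y0, b0)), continuous F}.
    rewrite /continuous_at /F /dot; apply: cvg_big => [|i _].
      exact: add_continuous.
    apply: cvgM.
      rewrite /= [X in _ --> X]mxE.
      have -> : (fun w : 'rV[R]_N * ('rV[R]_N * 'rV[R]_NB) => grad rho w.1 0 i) =
         (fun w => 'D_(basis_vec i) rho w.1) by apply/funext => w; rewrite mxE.
      apply: (@cvg_comp _ _ _ (fun w : 'rV[R]_N * ('rV[R]_N * 'rV[R]_NB) => w.1)
        ('D_(basis_vec i) rho) _ (nbhs y0)).
        exact: cvg_fst.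
      exact: Ck1_continuous_derive C1rho Uy0.
    apply: (@cvg_comp _ _ _ (fun w : 'rV[R]_N * ('rV[R]_N * 'rV[R]_NB) => w.2)
      (fun q => G q 0 i) _ (nbhs (y0, b0))); first exact: cvg_snd.
    apply: (@cvg_comp _ _ _ G (fun M : 'rV[R]_N => M 0 i) _ (nbhs (G (y0, b0)))).
      exact: cG.
    exact: coord_continuous.
  have /nbhs_ballP[e /= e0 He] : nbhs (y0, (y0, b0))
      [set w | [/\ U w.1, Z w.2 & 0 < F w]].
    have nU : nbhs (y0, (y0, b0)) [set w | U w.1].
      by apply: (cvg_fst (F := nbhs y0)); exact: (open_nbhs_nbhs (conj oU Uy0)).
    have nZ : nbhs (y0, (y0, b0)) [set w | Z w.2].
      by apply: (cvg_snd (G := nbhs (y0, b0))); exact: (open_nbhs_nbhs (conj oZ Zq0)).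
    have nF : nbhs (y0, (y0, b0)) [set w | 0 < F w] by exact: (cvgr_gt _ cF).
    by near=> w; split; near: w.
  exists (e / 2); first by rewrite divr_gt0.
  have e20 : 0 < e / 2 by rewrite divr_gt0.
  apply/nbhs_ballP; exists (e / 2) => //= -[y b].
  rewrite -ball_normE /= pair_dist_lt => /andP[yy0 bb0] [/= Oy Bb] r /andP[r0 re].
  have ray (s : R) : `|s| <= r -> [/\ U (y + s *: gam D y b) &
      0 < dot (grad rho (y + s *: gam D y b)) (gam D y b)].
    move=> sr.
    have [] : [set w | [/\ U w.1, Z w.2 & 0 < F w]] (y + s *: gam D y b, (y, b)).
      apply: He; rewrite -ball_normE /= !pair_dist_lt opprD addrA.
      have half : e / 2 < e by rewrite ltr_pdivrMr // ltr_pMr // ltr1n.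
      rewrite (lt_trans yy0 half) (lt_trans bb0 half) !andbT.
      rewrite (le_lt_trans (ler_normB _ _)) // [ltRHS](splitr e) ltrD //.
      rewrite normrZ (le_lt_trans _ re) // (le_trans _ sr) // ler_piMr //.
      exact: gam_norm_le.
    rewrite /F /= => Us Zs; rewrite GE //.
    by split => //=; exact: (nbhdB_sub hD).
  have U0 : U y by have [|+ _] := ray 0; rewrite ?normr0 ?(ltW r0)// scale0r addr0.
  have rho0 : rho y = 0 by apply/(Obd y U0).
  have step (c : R) : `|c| <= r ->
      exists2 p : R, 0 < p & rho (y + c *: gam D y b) = c * p.
    move=> cr.
    have sc (s : R) : 0 <= s <= 1 -> `|s * c| <= r.
      move=> /andP[s0 s1]; rewrite normrM (le_trans _ cr) // ler_piMl //.
      by rewrite ger0_norm.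
    have [s s01|s s01] := @mvt_dir _ _ rho y (c *: gam D y b).
      apply: Ck1_derivable C1rho _; rewrite scalerA.
      by have [] := ray _ (sc s s01).
    have [Us ps] := ray _ (sc s s01).
    rewrite scalerA deriveZ_dir; last exact: Ck1_derivable C1rho Us.
    rewrite rho0 subr0 (derive_dot _ oU C1rho Us) => ->.
    by eexists; first exact: ps.
  split.
    have [|p p0] := step (- r); first by rewrite normrN gtr0_norm.
    have [|Us _] := ray (- r); first by rewrite normrN gtr0_norm.
    move=> E; rewrite -scaleNr; apply/(Oin _ Us).
    by rewrite E mulNr oppr_lt0 mulr_gt0.
  have [|p p0] := step r; first by rewrite gtr0_norm.
  have [|Us _] := ray r; first by rewrite gtr0_norm.
  move=> E Cy.
  have rp : 0 < rho (y + r *: gam D y b) by rewrite E mulr_gt0.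
  have nO : ~ O (y + r *: gam D y b).
    by move=> /(Oin _ Us); rewrite ltNge (ltW rp).
  by have /(Obd _ Us) r0' := closureE Cy nO; rewrite r0' ltxx in rp.
by exists s0 => // y b r Oy Bb r0s; exact: (H (y, b)).
Unshelve. all: by end_near. Qed.

Lemma collar_near y X : boundary O y -> N%:R * `|X - y| < Defs.radius D ->
  collar D X.
Proof.
move=> Oy Xy; apply: le_lt_trans Xy; apply: le_trans (enorm_le_normr _).
apply: inf_lbound; last by exists y.
by exists 0 => _ [z _ <-]; exact: sqrtr_ge0.
Qed.

Lemma proj_dist_boundary y b : boundary O y -> B b -> proj_dist D y b = 0.
Proof.
move=> Oy Bb; have Cy : collar D y.
  by apply: (collar_near Oy); rewrite subrr normr0 mulr0 radius_gt0.
have [_ _ _ /(_ y 0 Oy)] := projP hD Cy Bb.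
rewrite normr0 scale0r addr0 => /(_ (delta_gt0 hD)) H.
by have [] := H erefl.
Qed.

(** The distance vanishes at y and is C^1 in X up to a local extension, so the
    mean value theorem on the segment from y to X bounds it; the scale e also
    serves as inverse Lipschitz constant, which makes the property monotone in
    e. *)
Lemma proj_dist_lipschitz : exists2 e : R, 0 < e &
  forall y b X, boundary O y -> B b -> collar D X -> `|X - y| < e ->
    `|proj_dist D X b| <= e^-1 * `|X - y|.
Proof.
pose P (e : R) (q : 'rV[R]_N * 'rV[R]_NB) := (boundary O `*` B) q ->
  forall X, collar D X -> `|X - q.1| < e ->
    `|proj_dist D X q.2| <= e^-1 * `|X - q.1|.
have [|e e' q /andP[e0 ee'] H Kq X cX Xe||e e0 H] :=
  @compact_uniform_scale R _ (boundary O `*` B) P.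
- apply: compact_setX; last exact: ctrlB_compact hD.
  by have [] := boundary_compact (dom_bounded hD).
- apply: le_trans (H Kq X cX (lt_le_trans Xe ee')) _.
  by rewrite ler_wpM2r // lef_pV2 // posrE // (lt_le_trans e0).
- move=> [y0 b0] [/= Oy0 Bb0].
  have col y : boundary O y -> collar D y.
    by move=> Oy; apply: (collar_near Oy); rewrite subrr normr0 mulr0 radius_gt0.
  have [Z [G [oZ Zq0 CG GE]]] : exists Z G,
      [/\ open Z, Z (y0, b0), Ck 1 Z G & forall y, Z y ->
        (collar D `*` B) y -> G y = proj_dist D y.1 y.2].
    by apply: (proj_dist_C1 hD (z := (y0, b0))); split => //=; exact: col.
  pose w i : 'rV[R]_N * 'rV[R]_NB := (basis_vec i, 0).
  pose m i := `|'D_(w i) G (y0, b0)| + 1.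
  have nG : nbhs (y0, b0) [set q | Z q /\ forall i, `|'D_(w i) G q| <= m i].
    have nZ : nbhs (y0, b0) Z by exact: (open_nbhs_nbhs (conj oZ Zq0)).
    suff nD : \forall q \near (y0, b0), forall i, `|'D_(w i) G q| <= m i.
      exact: filterI nZ nD.
    suff H i : \forall q \near (y0, b0), `|'D_(w i) G q| <= m i.
      exact: (@filter_forall _ _ (fun i q => is_true (`|'D_(w i) G q| <= m i))
        (nbhs (y0, b0)) _ H).
    have := Ck1_continuous_derive (v := w i) CG Zq0.
    move=> /cvgrPdist_le /(_ 1 ltr01); apply: filterS => q /= Hq.
    rewrite -lerBlDl (le_trans _ Hq) // distrC.
    exact: lerB_dist.
  have [rho /= rho0 Hr] := (nbhs_ballP _ _).1 nG.
  pose M := \sum_i m i.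
  have M0 : 0 <= M by apply: sumr_ge0 => i _; rewrite addr_ge0.
  pose e := Num.min (rho / 2) (M + 1)^-1.
  have e0 : 0 < e by rewrite lt_min divr_gt0 //= invr_gt0 ltr_wpDl.
  exists e => //; apply/nbhs_ballP; exists (rho / 2); rewrite /= ?divr_gt0 //.
  move=> [y b]; rewrite -ball_normE /= pair_dist_lt => /andP[yy0 bb0].
  move=> [/= Oy Bb] X cX Xe.
  have seg (s : R) : 0 <= s <= 1 ->
      [set q | Z q /\ forall i, `|'D_(w i) G q| <= m i] ((y, b) + s *: (X - y, 0)).
    move=> /andP[s0 s1].
    have -> : (y, b) + s *: (X - y, 0) = (y + s *: (X - y), b) :> 'rV[R]_N * 'rV[R]_NB.
      by congr pair; rewrite /= scaler0 addr0.
    apply: Hr; rewrite -ball_normE /= pair_dist_lt.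
    rewrite (lt_trans bb0) ?andbT; last first.
      by rewrite ltr_pdivrMr // ltr_pMr // ltr1n.
    rewrite opprD addrA (le_lt_trans (ler_normB _ _)) // [ltRHS](splitr rho).
    rewrite ltrD // normrZ ger0_norm // (@le_lt_trans _ _ (`|X - y|)) //.
      by rewrite ler_piMl.
    by rewrite (lt_le_trans Xe) // ge_min lexx.
  have XE : (X, b) = (y, b) + (X - y, 0) :> 'rV[R]_N * 'rV[R]_NB.
    by congr pair; rewrite /= ?addr0 // subrKC.
  have Zy : Z (y, b).
    by have [|+ _] := seg 0; [rewrite lexx ler01|rewrite scale0r addr0].
  have ZX : Z (X, b).
    by have [|+ _] := seg 1; [rewrite lexx ler01|rewrite scale1r -XE].
  have -> : proj_dist D X b = G (X, b) - G (y, b).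
    rewrite (GE _ Zy) /=; last by split => //; exact: col.
    by rewrite (proj_dist_boundary Oy Bb) subr0 (GE _ ZX).
  have [s s01|s s01] := @mvt_dir _ _ G (y, b) (X - y, 0).
    by apply: Ck1_derivable CG _; have [] := seg s s01.
  have [Zs ms] := seg s s01.
  rewrite -XE => ->; move: Zs ms; set q := _ + s *: _ => Zs ms.
  have -> : (X - y, 0) = \sum_i (X - y) 0 i *: w i :> 'rV[R]_N * 'rV[R]_NB.
    rewrite {1}(row_basis (X - y)).
    elim/big_rec2: _ => // i u1 u2 _ <-.
    by congr pair; rewrite /= scaler0 add0r.
  rewrite (derive_sum_dir _ _ oZ CG Zs).
  apply: (@le_trans _ _ (\sum_i `|X - y| * m i)).
    rewrite (le_trans (ler_norm_sum _ _ _)) // ler_sum // => i _.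
    by rewrite normrM ler_pM // mx_entry_le.
  rewrite -mulr_sumr mulrC ler_wpM2r //.
  rewrite -/M (@le_trans _ _ (M + 1)) // ?lerDl //.
  rewrite -[leLHS]invrK lef_pV2 ?posrE // ?invr_gt0 ?ltr_wpDl //.
  by rewrite ge_min lexx orbT.
by exists e => // y b X Oy Bb; apply: (H (y, b)).
Qed.

(** The distance bound is the Lipschitz estimate at a point where the segment
    from x to X crosses the boundary.  The other claims come from oblique_ray:
    a negative d would put X itself in the domain, and a positive one puts the
    reflected point there. *)
Lemma exit_geometry : exists K e : R, [/\ 0 < K, 0 < e &
  forall x X b, O x -> ~ closure O X -> B b -> `|X - x| < e ->
  let y := proj_pt D X b in let d := proj_dist D X b in
  [/\ boundary O y, X = y + d *: gam D y b, 0 < d, d <= K * `|X - x| &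
      O (y - d *: gam D y b)]].
Proof.
have [s0 s00 ray] := oblique_ray; have [e1 e10 lip] := proj_dist_lipschitz.
exists e1^-1.
(* The three bounds give the Lipschitz estimate, |d| < s0, and membership in the
   collar; the last compares the Euclidean norm with the sup norm. *)
pose e := Num.min e1 (Num.min (e1 * s0) (Defs.radius D / N.+1%:R)).
have e0 : 0 < e.
  by rewrite !lt_min e10 mulr_gt0 //= divr_gt0 // radius_gt0.
exists e; split => //; first by rewrite invr_gt0.
move=> x X b Ox CX Bb; rewrite !lt_min => /and3P[xe1 xe2 xe3] y d.
have [s /andP[s0' s1] Oz] := segment_crosses_boundary (dom_open hD) Ox CX.
set z := x + _ in Oz.
have Xz : `|X - z| <= `|X - x|.
  have -> : X - z = (1 - s) *: (X - x).
    by rewrite /z scalerBl scale1r opprD addrA.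
  rewrite normrZ ger0_norm ?subr_ge0 // ler_piMl //.
  by rewrite lerBlDr lerDl.
have cX : collar D X.
  apply: (collar_near Oz); apply: le_lt_trans (_ : N.+1%:R * `|X - x| < _).
    by rewrite ler_pM // ler_nat.
  by rewrite mulrC -ltr_pdivlMr.
have [Oy _ XE uniq] := projP hD cX Bb; rewrite -/y -/d in Oy XE uniq.
have dK : `|d| <= e1^-1 * `|X - x|.
  apply: (le_trans (lip z b X Oz Bb cX (le_lt_trans Xz xe1))).
  by rewrite ler_wpM2l // invr_ge0 ltW.
have ds0 : `|d| < s0.
  by rewrite (le_lt_trans dK) // mulrC ltr_pdivrMr // mulrC.
have d0 : 0 < d.
  rewrite ltNge; apply/negP => d0; apply: CX.
  move: d0; rewrite le_eqVlt => /orP[/eqP d0|d0].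
    by rewrite XE d0 scale0r addr0; case: Oy.
  have [|] := ray y b (- d) Oy Bb; first by rewrite oppr_gt0 d0 -(ltr0_norm d0).
  by rewrite scaleNr opprK -XE => /subset_closure.
split => //; first by rewrite -(gtr0_norm d0).
by have [|] := ray y b d Oy Bb; rewrite // d0 -(gtr0_norm d0).
Qed.

End Geometry.

(** * Uniform bounds on the data *)

Section Bounds.
Context {R : realType} {N Np NA NB : nat}.
Variables (D : control_data R N Np NA NB) (hD : standing D).

Local Notation O := (dom D).

Lemma times_compact : compact (times D).
Proof.
suff -> : times D = `[0, horizon D]%classic by exact: segment_compact.
by apply/seteqP; split => t /=; rewrite in_itv.
Qed.

Lemma closedQ_compact : compact (closedQ D).
Proof.
apply: compact_setX; first exact: times_compact.
by have [] := boundary_compact (dom_bounded hD).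
Qed.

Lemma closedQA_compact : compact (closedQA D).
Proof. by apply: compact_setX; [exact: closedQ_compact|exact: ctrlA_compact hD]. Qed.

Lemma lateralB_compact : compact (lateralB D).
Proof.
apply: compact_setX; last exact: ctrlB_compact hD.
apply: compact_setX; first exact: times_compact.
by have [] := boundary_compact (dom_bounded hD).
Qed.

Lemma data_bound : exists2 K : R, 1 <= K &
  (forall t x a, closedQA D (t, x, a) ->
     [/\ `|sigma D t x a| <= K, `|mu D t x a| <= K, `|cost_f D t x a| <= K &
         0 <= rate_r D t x a <= K]) /\
  (forall t x b, lateralB D (t, x, b) ->
     `|cost_g D t x b| <= K /\ 0 <= rate_k D t x b <= K).
Proof.
have [K1 H1] := compact_bound closedQA_compact (sigma_continuous hD).
have [K2 H2] := compact_bound closedQA_compact (mu_continuous hD).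
have [K3 H3] := compact_bound closedQA_compact (f_continuous hD).
have [K4 H4] := compact_bound closedQA_compact (r_continuous hD).
have [K5 H5] := compact_bound lateralB_compact (g_continuous hD).
have [K6 H6] := compact_bound lateralB_compact (k_continuous hD).
pose K := 1 + \sum_(k <- [:: K1; K2; K3; K4; K5; K6]) `|k|.
have le k : k \in [:: K1; K2; K3; K4; K5; K6] -> k <= K.
  move=> kin; rewrite /K (big_rem k) //= addrA.
  rewrite (@le_trans _ _ (1 + `|k|)) // ?lerDl ?sumr_ge0 //.
  by rewrite (le_trans (ler_norm _)) // lerDr.
exists K; first by rewrite lerDl sumr_ge0.
have L k u : k \in [:: K1; K2; K3; K4; K5; K6] -> u <= k -> u <= K.
  by move=> /le kK /le_trans; apply.
split=> t x c Q.
  split; [apply: (L K1); last exact: (H1 _ Q)|apply: (L K2); last exact: (H2 _ Q)|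
    apply: (L K3); last exact: (H3 _ Q)|]; rewrite ?inE ?eqxx ?orbT //.
  rewrite (r_ge0 hD) //= (le_trans (ler_norm _)) //.
  by apply: (L K4); last exact: (H4 _ Q); rewrite ?inE ?eqxx ?orbT.
split; first by apply: (L K5); last exact: (H5 _ Q); rewrite ?inE ?eqxx ?orbT.
rewrite (k_ge0 hD) //= (le_trans (ler_norm _)) //.
by apply: (L K6); last exact: (H6 _ Q); rewrite ?inE ?eqxx ?orbT.
Qed.

Lemma open_margin (V : normedModType R) (K W : set V) : compact K -> open W ->
  K `<=` W -> exists2 e : R, 0 < e & forall q v, K q -> `|v| < e -> W (q + v).
Proof.
move=> cK oW KW.
have [|q Kq|e e0 H] := @compact_uniform_scale R V K
  (fun e q => forall v, `|v| < e -> W (q + v)) cK.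
- by move=> e e' q /andP[_ ee'] H v ve; apply: H; exact: lt_le_trans ve ee'.
- have /nbhs_ballP[r /= r0 Hr] := open_nbhs_nbhs (conj oW (KW q Kq)).
  exists (r / 2); first by rewrite divr_gt0.
  apply/nbhs_ballP; exists (r / 2); rewrite /= ?divr_gt0 // => y.
  rewrite -ball_normE /= => qy v ve; apply: Hr; rewrite -ball_normE /=.
  by rewrite opprD addrA (le_lt_trans (ler_normB _ _)) // [ltRHS](splitr r) ltrD.
by exists e => // q v Kq; exact: H.
Qed.

End Bounds.

(** * Scalar expansions *)

Section RealExpansions.
Context {R : realType}.
Implicit Types (z C u : R).

Let is_derive_expRN z c (s : R) :
  is_derive s 1 (fun r : R => c * expR (- (r * z))) (- (c * z) * expR (- (s * z))).
Proof.
have D : is_derive s 1 (fun r : R => - (r * z)) (- z).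
  have -> : (fun r : R => - (r * z)) = (- z) \*: (@id R).
    by apply/funext => r; rewrite [RHS]mulNr mulrC.
  by apply: is_derive_eq; rewrite [LHS]mulr1.
have D1 := @is_derive1_comp _ expR (fun r : R => - (r * z)) _ _ _
  (is_derive_expR _) D.
have D2 := is_deriveZ c D1.
apply: (is_derive_eq D2).
by rewrite /GRing.scale /=; ring.
Qed.

Let expRN_le (c z s : R) : 0 <= c -> 0 <= z -> 0 <= s ->
  `|c * expR (- (s * z))| <= c.
Proof.
move=> c0 z0 s0; rewrite normrM ger0_norm // ler_piMr // ger0_norm ?expR_ge0 //.
by rewrite -expR0 ler_expR oppr_le0 mulr_ge0.
Qed.

Lemma expRN_taylor2 z : 0 <= z -> `|expR (- z) - 1 + z| <= z ^+ 2.
Proof.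
move=> z0.
have := @taylor2_1d R (fun r => 1 * expR (- (r * z)))
  (fun r => (- z) * expR (- (r * z)))
  (fun r => z ^+ 2 * expR (- (r * z))) (z ^+ 2).
rewrite /= mul0r oppr0 expR0 !mulr1 !mul1r opprK; apply.
- move=> s _; apply: (is_derive_eq (is_derive_expRN z 1 s)).
  by rewrite mul1r.
- move=> s _; apply: (is_derive_eq (is_derive_expRN z (- z) s)).
  by rewrite [- z * z]mulNr opprK -expr2.
- by move=> s /andP[s0 _]; rewrite expRN_le ?sqr_ge0.
Qed.

Lemma expRN_taylor3 z : 0 <= z ->
  `|expR (- z) - 1 + z - 2^-1 * z ^+ 2| <= z ^+ 3.
Proof.
move=> z0.
have := @taylor3_1d R (fun r => 1 * expR (- (r * z)))
  (fun r => (- z) * expR (- (r * z)))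
  (fun r => z ^+ 2 * expR (- (r * z)))
  (fun r => (- z ^+ 3) * expR (- (r * z))) (z ^+ 3).
rewrite /= mul0r oppr0 expR0 !mulr1 !mul1r opprK; apply.
- move=> s _; apply: (is_derive_eq (is_derive_expRN z 1 s)).
  by rewrite mul1r.
- move=> s _; apply: (is_derive_eq (is_derive_expRN z (- z) s)).
  by rewrite [- z * z]mulNr opprK -expr2.
- move=> s _; apply: (is_derive_eq (is_derive_expRN z (z ^+ 2) s)).
  by rewrite -exprSr.
- by move=> s /andP[s0 _]; rewrite mulNr normrN expRN_le ?exprn_ge0.
Qed.

Lemma discount_taylor u : 0 <= u ->
  [/\ 0 < (1 + u)^-1 <= 1, `|(1 + u)^-1 - 1| <= u &
      `|(1 + u)^-1 - 1 + u| <= u ^+ 2].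
Proof.
move=> u0; have u1 : 0 < 1 + u by lra.
have ne : 1 + u != 0 by lra.
have i0 : 0 < (1 + u)^-1 by rewrite invr_gt0.
have i1 : (1 + u)^-1 <= 1 by rewrite invf_le1 // lerDl.
have i0' := ltW i0.
split; first by rewrite i0.
- have -> : (1 + u)^-1 - 1 = - (u * (1 + u)^-1) by field.
  by rewrite normrN ger0_norm ?mulr_ge0 // ler_piMr.
- have -> : (1 + u)^-1 - 1 + u = u ^+ 2 * (1 + u)^-1 by field.
  by rewrite ger0_norm ?mulr_ge0 ?sqr_ge0 // ler_piMr ?sqr_ge0.
Qed.

(** Fs and Ft stand for phi(t + dt, .) at X* and at the reflected point, z for
    phi(t, .) at the boundary point between them, gp for its oblique derivative
    there, and s for the square root of dt.  The difference splits into the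
    Taylor remainders of the two exponentials, the two hypotheses on phi, of
    which the second carries the weight -k d + (k d)^2 / 2 of order s, and the
    monomial k^2 d^3 gp / 4. *)
Lemma reflection_expansion C : 1 <= C -> exists C' : R, forall s k d g z gp Fs Ft,
  0 <= s <= 1 -> 0 <= d <= C * s -> 0 <= k <= C -> `|g| <= C -> `|gp| <= C ->
  `|Ft| <= C -> `|Fs - Ft - d * gp| <= C * s ^+ 3 ->
  `|Ft - z + d / 2 * gp| <= C * s ^+ 2 ->
  `|expR (- (k * d)) * Ft + d * expR (- (k * d / 2)) * g
    - (Fs - d * (gp + k * z - g)
       + d ^+ 2 * (2^-1 * k ^+ 2 * z - 2^-1 * k * g + 2^-1 * k * gp))|
  <= C' * s ^+ 3.
Proof.
move=> C1; have C0 : 0 <= C by lra.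
exists (C ^+ 7 + C ^+ 6 + C + 2 * C ^+ 5 + C ^+ 6).
move=> s k d g z gp Fs Ft /andP[s0 s1] /andP[d0 dC] /andP[k0 kC] gC gpC FtC e3 e2.
have kd0 : 0 <= k * d by rewrite mulr_ge0.
have kdC : k * d <= C ^+ 2 * s.
  by rewrite expr2 -mulrA ler_pM.
have Cs0 : 0 <= C ^+ 2 * s by rewrite mulr_ge0 // exprn_ge0.
have T1 : `|(expR (- (k * d)) - 1 + k * d - 2^-1 * (k * d) ^+ 2) * Ft|
    <= C ^+ 7 * s ^+ 3.
  rewrite normrM (_ : C ^+ 7 * s ^+ 3 = (C ^+ 2 * s) ^+ 3 * C); last by ring.
  rewrite ler_pM // (le_trans (expRN_taylor3 kd0)) //.
  by rewrite lerXn2r ?nnegrE.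
have T2 : `|d * g * (expR (- (k * d / 2)) - 1 + k * d / 2)| <= C ^+ 6 * s ^+ 3.
  rewrite normrM (_ : C ^+ 6 * s ^+ 3 = (C * s) * C * (C ^+ 2 * s) ^+ 2); last by ring.
  rewrite ler_pM // ?normrM ?(ger0_norm d0) ?ler_pM //.
  rewrite (le_trans (expRN_taylor2 _)) ?divr_ge0 //.
  rewrite lerXn2r ?nnegrE ?divr_ge0 // (le_trans _ kdC) //.
  by rewrite ler_pdivrMr // ler_peMr // ler1n.
have T4 : `|(- (k * d) + 2^-1 * (k * d) ^+ 2) * (Ft - z + d / 2 * gp)|
    <= 2 * C ^+ 5 * s ^+ 3.
  rewrite normrM (_ : 2 * C ^+ 5 * s ^+ 3 = 2 * (C ^+ 4 * s) * (C * s ^+ 2)); last by ring.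
  rewrite ler_pM // (le_trans (ler_normD _ _)) //.
  rewrite (_ : 2 * (C ^+ 4 * s) = C ^+ 4 * s + C ^+ 4 * s); last by ring.
  have C24 : C ^+ 2 <= C ^+ 4 by rewrite ler_weXn2l.
  rewrite lerD //.
    by rewrite normrN ger0_norm // (le_trans kdC) // ler_wpM2r.
  rewrite ger0_norm ?mulr_ge0 ?sqr_ge0 //.
  rewrite (@le_trans _ _ ((k * d) ^+ 2)) //.
    by rewrite ler_piMl ?sqr_ge0 //; lra.
  rewrite (@le_trans _ _ ((C ^+ 2 * s) ^+ 2)) ?lerXn2r ?nnegrE //.
  rewrite exprMn -exprM ler_wpM2l ?exprn_ge0 //.
  by rewrite expr2 ler_piMl.
have T5 : `|- (k ^+ 2 * d ^+ 3 / 4 * gp)| <= C ^+ 6 * s ^+ 3.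
  rewrite normrN normrM (_ : C ^+ 6 * s ^+ 3 = (C ^+ 2 * (C * s) ^+ 3) * C); last by ring.
  have p0 : 0 <= k ^+ 2 * d ^+ 3 by rewrite mulr_ge0 ?exprn_ge0.
  rewrite ler_pM // ger0_norm ?divr_ge0 //.
  rewrite (@le_trans _ _ (k ^+ 2 * d ^+ 3)) //.
    by rewrite ler_pdivrMr // ler_peMr // ler1n.
  by rewrite ler_pM ?exprn_ge0 // lerXn2r ?nnegrE // mulr_ge0.
set x1 := (X in `|X| <= _) in T1; set x2 := (X in `|X| <= _) in T2.
set x3 := (X in `|X| <= _) in e3; set x4 := (X in `|X| <= _) in T4.
set x5 := (X in `|X| <= _) in T5.
rewrite (_ : _ - _ = x1 + x2 - x3 + x4 + x5); last first.
  by rewrite /x1 /x2 /x3 /x4 /x5; field.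
rewrite [leRHS](_ : _ = C ^+ 7 * s ^+ 3 + C ^+ 6 * s ^+ 3 + C * s ^+ 3 +
  2 * C ^+ 5 * s ^+ 3 + C ^+ 6 * s ^+ 3); last by ring.
rewrite (le_trans (ler_normD _ _)) // lerD //.
rewrite (le_trans (ler_normD _ _)) // lerD //.
rewrite (le_trans (ler_normB _ _)) // lerD //.
by rewrite (le_trans (ler_normD _ _)) // lerD.
Qed.

(** Applied to d = D_v D_v phi with v = s^2 u + s w: of its four terms only
    s^2 D_w D_w phi is not O(s^3). *)
Lemma quadratic_remainder_le (s d du dw d11 d12 d21 d22 C : R) :
  0 <= s <= 1 -> d = s ^+ 2 * du + s * dw -> du = s ^+ 2 * d11 + s * d12 ->
  dw = s ^+ 2 * d21 + s * d22 ->
  `|d11| <= C -> `|d12| <= C -> `|d21| <= C ->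
  `|d - s ^+ 2 * d22| <= 3 * C * s ^+ 3.
Proof.
move=> /andP[s0 s1] -> -> -> b11 b12 b21.
have s3 : 0 <= s ^+ 3 by rewrite exprn_ge0.
have -> : s ^+ 2 * (s ^+ 2 * d11 + s * d12) + s * (s ^+ 2 * d21 + s * d22)
     - s ^+ 2 * d22 = (s * d11 + d12 + d21) * s ^+ 3 by ring.
rewrite normrM (ger0_norm s3) ler_wpM2r //.
have -> : 3 * C = C + C + C by ring.
rewrite (le_trans (ler_normD _ _)) // lerD // (le_trans (ler_normD _ _)) // lerD //.
by rewrite normrM ger0_norm // (le_trans _ b11) // ler_piMl.
Qed.

Lemma half_remainder_le (a d2 d2' B C : R) :
  `|a - 2^-1 * d2| <= B -> `|d2 - d2'| <= C -> `|a - 2^-1 * d2'| <= B + C.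
Proof. by rewrite !ler_norml => /andP[? ?] /andP[? ?]; apply/andP; split; lra. Qed.

Lemma symmetric_difference_le (a b c d1 d2 K : R) :
  `|a - c - d1 - 2^-1 * d2| <= K -> `|b - c - - d1 - 2^-1 * d2| <= K ->
  `|a - b - 2 * d1| <= 2 * K.
Proof. by rewrite !ler_norml => /andP[? ?] /andP[? ?]; apply/andP; split; lra. Qed.

Lemma sqrt_small (r : R) : 0 < r -> exists2 dt0 : R, 0 < dt0 &
  forall dt : R, 0 < dt <= dt0 ->
    [/\ 0 < Num.sqrt dt, Num.sqrt dt < r, Num.sqrt dt <= 1 &
        Num.sqrt dt ^+ 2 = dt].
Proof.
move=> r0; pose m := Num.min (r / 2) 1.
have m0 : 0 < m by rewrite lt_min ltr01 divr_gt0.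
exists (m ^+ 2); first by rewrite exprn_gt0.
move=> dt /andP[dt0 dtm].
have sm : Num.sqrt dt <= m.
  by rewrite -(ger0_norm (ltW m0)) -sqrtr_sqr ler_wsqrtr.
split; first by rewrite sqrtr_gt0.
- apply: (le_lt_trans sm); rewrite gt_min; apply/orP; left.
  by rewrite ltr_pdivrMr // ltr_pMr // ltr1n.
- by apply: (le_trans sm); rewrite ge_min lexx orbT.
- by rewrite sqr_sqrtr // ltW.
Qed.

Lemma powR_three_halves (a : R) : 0 < a ->
  a `^ (3 / 2) = Num.sqrt a ^+ 3.
Proof.
move=> a0; rewrite (_ : 3 / 2 = 2^-1 * 3%:R); last by field.
by rewrite powRrM powR_mulrn ?powR_ge0 // powR12_sqrt // ltW.
Qed.

(** Discounting subtracts u z and leaves the higher-order terms u^2 z and u m: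
    inside, u = r dt and m = O(dt^(1/2)); at the boundary, u = l k and m = O(l).
    The remainder y is not amplified. *)
Lemma discount_expansion (u z m y : R) : 0 <= u ->
  `|(1 + u)^-1 * (z + m + y) - (z + m - u * z)| <= u ^+ 2 * `|z| + u * `|m| + `|y|.
Proof.
move=> u0; have [/andP[r0 r1] t1 t2] := discount_taylor u0.
set r := (1 + u)^-1 in r0 r1 t1 t2 *.
rewrite (_ : _ - _ = (r - 1 + u) * z + (r - 1) * m + r * y); last by ring.
rewrite (le_trans (ler_normD _ _)) // lerD //.
  rewrite (le_trans (ler_normD _ _)) // lerD // normrM ler_wpM2r //.
by rewrite normrM gtr0_norm // ler_piMl.
Qed.

End RealExpansions.

(** * The test function in space-time *)

Section SpaceTime.
Context {R : realType} {N : nat}.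
Implicit Types (phi : R * 'rV[R]_N -> R) (x v : 'rV[R]_N) (t : R).

Definition st_basis (j : option 'I_N) : R * 'rV[R]_N :=
  if j is Some i then (0, basis_vec i) else (1, 0).

Definition st_coord (q : R * 'rV[R]_N) (j : option 'I_N) : R :=
  if j is Some i then q.2 0 i else q.1.

Lemma st_sum q : q = \sum_j st_coord q j *: st_basis j.
Proof.
rewrite (bigD1 None) //=.
have -> : \sum_(j | j != None) st_coord q j *: st_basis j =
    (0, \sum_i q.2 0 i *: basis_vec i) :> R * 'rV[R]_N.
  rewrite (reindex_omap Some id) /=; last by case.
  under eq_bigl do rewrite eqxx.
  elim/big_rec2: _ => // i u1 u2 _ ->.
  by congr pair; rewrite /= scaler0 add0r.
by rewrite -row_basis; case: q => t x; congr pair;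
  rewrite /= ?[t%:A]mulr1 ?addr0 // scaler0 add0r.
Qed.

Lemma st_coord_le q j : `|st_coord q j| <= `|q|.
Proof.
case: q j => t x [i|] /=; rewrite prod_normE le_max /= ?lexx //.
by rewrite mx_entry_le orbT.
Qed.

(** Difference quotients of a time slice are difference quotients in space-time,
    so spatial derivatives at fixed t are iterated derivatives of phi. *)
Lemma slice_quotient phi t x v :
  (fun h : R => h^-1 *: (((fun y => phi (t, y)) \o shift x) (h *: v)
     - phi (t, x))) =
  (fun h : R => h^-1 *: ((phi \o shift (t, x)) (h *: ((0, v) : R * 'rV[R]_N))
     - phi (t, x))).
Proof.
apply/funext => h /=.
by rewrite (_ : h *: (0, v) + (t, x) = (t, h *: v + x)) //;
  congr pair; rewrite /= scaler0 add0r.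
Qed.

Lemma iter_derive_slice phi t (s : seq 'rV[R]_N) :
  iter_derive s (fun y => phi (t, y)) =
  (fun y => iter_derive (map (pair 0) s) phi (t, y)).
Proof.
elim: s => //= v s ->; apply/funext => y.
by rewrite /derive -slice_quotient.
Qed.

Lemma derive_time phi t x :
  derive1 (fun s : R => phi (s, x)) t = 'D_((1, 0) : R * 'rV[R]_N) phi (t, x).
Proof.
rewrite derive1E /derive; congr (lim (_ @ 0^')); apply/funext => h /=.
by rewrite (_ : h *: (1, 0) + (t, x) = (h%:A + t, x)) //;
  congr pair; rewrite /= scaler0 add0r.
Qed.

Lemma derive_st (U : set (R * 'rV[R]_N)) phi t x tau v : open U -> Ck 1 U phi ->
  U (t, x) -> 'D_((tau, v) : R * 'rV[R]_N) phi (t, x) =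
  tau * derive1 (fun s : R => phi (s, x)) t +
  dot v (grad (fun y => phi (t, y)) x).
Proof.
move=> oU C1 Ux; rewrite {1}(st_sum (tau, v)) (derive_sum_dir _ _ oU C1 Ux).
rewrite (bigD1 None) //= derive_time; congr (_ + _).
rewrite (reindex_omap Some id) /=; last by case.
under eq_bigl do rewrite eqxx.
by apply: eq_bigr => i _; rewrite mxE iter_derive_slice.
Qed.

Lemma derive2_hess (U : set (R * 'rV[R]_N)) phi t x v : open U -> Ck 2 U phi ->
  U (t, x) -> iter_derive [:: (0, v); (0, v)] phi (t, x) =
  \sum_i \sum_j v 0 i * v 0 j * hess (fun y => phi (t, y)) x i j.
Proof.
move=> oU C2 Ux.
have E : (0, v) = \sum_i v 0 i *: (0, basis_vec i) :> R * 'rV[R]_N.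
  rewrite {1}(row_basis v); elim/big_rec2: _ => // i u1 u2 _ <-.
  by congr pair; rewrite /= scaler0 add0r.
have outer := @iter_derive_multilinear _ _ 2 U phi [:: (0, v)] [::] (t, x) _
  (fun j => v 0 j) (fun j => (0, basis_vec j)) oU C2 Ux isT.
have inner i := @iter_derive_multilinear _ _ 2 U phi [::] [:: (0, basis_vec i)]
  (t, x) _ (fun j => v 0 j) (fun j => (0, basis_vec j)) oU C2 Ux isT.
rewrite -E /= in outer; rewrite /= outer; apply: eq_bigr => i _.
have := inner i; rewrite -E /= => ->; rewrite mulr_sumr.
by apply: eq_bigr => j _; rewrite mxE iter_derive_slice mulrA.
Qed.

End SpaceTime.

Section TestFunction.
Context {R : realType} {N Np NA NB : nat}.
Variables (D : control_data R N Np NA NB) (hD : standing D).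
Variables (W : set (R * 'rV[R]_N)) (phi : R * 'rV[R]_N -> R).
Hypothesis hphi : test_function D W phi.

Local Notation O := (dom D).

(** All remainder estimates below depend on phi through these two constants only.
    The margin e is there because X* may leave closure O, so expansions run along
    segments outside the space-time cylinder. *)
Definition phi_controls (K e : R) : Prop :=
  [/\ forall q v, closedQ D q -> `|v| < e -> W (q + v),
      forall q, closedQ D q -> `|phi q| <= K,
      forall q u, W q -> `|'D_u phi q| <= K * `|u|,
      forall q u v, W q -> `|'D_u ('D_v phi) q| <= K * `|u| * `|v| &
      forall q u v w, W q ->
        `|'D_u ('D_v ('D_w phi)) q| <= K * `|u| * `|v| * `|w|].

Lemma phi_controlled : exists K e : R, [/\ 1 <= K, 0 < e & phi_controls K e].
Proof.
have [oW QW C3 b] := hphi.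
have [e e0 We] := open_margin (closedQ_compact hD) oW QW.
have [K0 HK0] : exists M : R, forall q, closedQ D q -> `|phi q| <= M.
  apply: compact_bound; first exact: closedQ_compact.
  apply: continuous_in_subspaceT => q; rewrite inE => /QW Wq.
  by have [] := C3 [::] q Wq isT.
have B := iter_derive_bound st_sum st_coord_le oW C3 b.
have [K1 K10 HK1] := B 1%N isT.
have [K2 K20 HK2] := B 2%N isT.
have [K3 K30 HK3] := B 3%N isT.
pose K := 1 + `|K0| + K1 + K2 + K3.
have [k0 k1 k2 k3 kk] : [/\ K0 <= K, K1 <= K, K2 <= K, K3 <= K & 1 <= K].
  by have := ler_norm K0; have := normr_ge0 K0; rewrite /K; split; lra.
exists K, e; split => //; split => //.
- by move=> q /HK0 /le_trans; apply.
- move=> q u Wq; have := HK1 [:: u] q erefl Wq; rewrite big_seq1 => /le_trans.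
  by apply; rewrite ler_wpM2r.
- move=> q u v Wq; have := HK2 [:: u; v] q erefl Wq.
  rewrite big_cons big_seq1 mulrA => /le_trans.
  by apply; rewrite ler_wpM2r // ler_wpM2r.
- move=> q u v w Wq; have := HK3 [:: u; v; w] q erefl Wq.
  rewrite !big_cons big_nil mulr1 !mulrA => /le_trans.
  by apply; do 3 rewrite ler_wpM2r //.
Qed.

Variables K e : R.
Hypothesis hK : phi_controls K e.

Lemma segW q v : closedQ D q -> `|v| < e ->
  forall s : R, 0 <= s <= 1 -> W (q + s *: v).
Proof.
move=> Qq ve s /andP[s0 s1]; have [H _ _ _ _] := hK; apply: H => //.
by rewrite normrZ ger0_norm // (le_lt_trans _ ve) // ler_piMl.
Qed.

Lemma phi_taylor2 q v : closedQ D q -> `|v| < e ->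
  `|phi (q + v) - phi q - 'D_v phi q| <= K * `|v| ^+ 2.
Proof.
have [oW QW C3 _] := hphi; have [_ _ _ H _] := hK => Qq ve.
apply: (taylor2 (U := W)); [exact: Ck_le C3|exact: segW|].
by move=> p /H; rewrite expr2 mulrA.
Qed.

Lemma phi_taylor3 q v : closedQ D q -> `|v| < e ->
  `|phi (q + v) - phi q - 'D_v phi q - 2^-1 * 'D_v ('D_v phi) q|
    <= K * `|v| ^+ 3.
Proof.
have [oW QW C3 _] := hphi; have [_ _ _ _ H] := hK => Qq ve.
apply: (taylor3 (U := W)) => //; first exact: segW.
by move=> p /H; rewrite !exprS expr0 mulr1 !mulrA.
Qed.

Lemma derive_phi_taylor1 q u v : closedQ D q -> `|v| < e ->
  `|'D_u phi (q + v) - 'D_u phi q| <= K * `|u| * `|v|.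
Proof.
have [oW QW C3 _] := hphi; have [_ _ _ H _] := hK => Qq ve.
apply: (taylor1 (U := W) (G := 'D_u phi)); last 1 first.
- by move=> p /H; rewrite mulrAC.
- exact: (Ck_iter (s := [:: u]) C3).
- exact: segW.
Qed.

(** The even Taylor terms cancel between two points placed symmetrically about
    q; this is what makes reflection accurate to third order. *)
Lemma phi_symmetric_difference q v : closedQ D q -> `|v| < e ->
  `|phi (q + v) - phi (q - v) - 2 * 'D_v phi q| <= 2 * K * `|v| ^+ 3.
Proof.
have [oW QW C3 _] := hphi => Qq ve.
have Wq := QW _ Qq.
have C1 : Ck 1 W phi by exact: Ck_le C3.
have C2 : Ck 2 W phi by exact: Ck_le C3.
have T1 := phi_taylor3 Qq ve.
have ve' : `|- v| < e by rewrite normrN.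
have := phi_taylor3 Qq ve'.
have N1 : 'D_(- v) phi q = - 'D_v phi q.
  rewrite -scaleN1r deriveZ_dir ?mulN1r //.
  exact: Ck1_derivable C1 Wq.
have N2 : 'D_(- v) ('D_(- v) phi) q = 'D_v ('D_v phi) q.
  have outer := @iter_derive_scale _ _ 2 W phi [:: (-1) *: v] [::] q (-1) v
    oW C2 Wq isT.
  have inner := @iter_derive_scale _ _ 2 W phi [::] [:: v] q (-1) v oW C2 Wq isT.
  rewrite /= in outer inner.
  have Nv : - v = (-1) *: v by rewrite scaleN1r.
  by rewrite Nv [LHS]outer inner !mulN1r opprK.
rewrite N1 N2 normrN => T2.
by rewrite -mulrA; exact: symmetric_difference_le T1 T2.
Qed.

(** What the interpolation estimate of the meshes asks of a time slice, with a
    bound on the C^2 norm uniform in t. *)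
Lemma phi_slice_Ck_closure t : times D t ->
  Ck_closure 2 O (fun y => phi (t, y)) /\
  0 <= Ck_norm 2 O (fun y => phi (t, y)) <= K.
Proof.
have [oW QW C3 _] := hphi; have [_ H0 H1 H2 _] := hK => tT.
have Qt x : closure O x -> closedQ D (t, x) by [].
have cs (s : seq 'rV[R]_N) x : closure O x -> (size s <= 2)%N ->
    {for x, continuous (iter_derive s (fun y => phi (t, y)))}.
  move=> cx s2; rewrite iter_derive_slice.
  have [|+ _] := C3 (map (pair 0) s) (t, x) (QW _ (Qt x cx)).
    by rewrite size_map (leq_trans s2).
  move=> cf; apply: (@cvg_comp _ _ _ (fun y : 'rV[R]_N => (t, y))
    (iter_derive (map (pair 0) s) phi) _ (nbhs (t, x))) => //.
  by apply: (@cvg_pair _ _ _ (nbhs x) (nbhs t) (nbhs x) _ _ _ (cst t) id);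
    [exact: cvg_cst|exact: cvg_id].
split; first split.
- move=> s x Ox s2; split; first by apply: cs => //; exact: subset_closure.
  move=> s2' v; rewrite iter_derive_slice.
  have Cx := subset_closure Ox.
  have [|_ /(_ _ (0, v))] := C3 (map (pair 0) s) (t, x) (QW _ (Qt x Cx)).
    by rewrite size_map (leq_trans s2).
  rewrite size_map (leq_trans s2') // => /(_ isT).
  by rewrite /derivable -slice_quotient.
- by apply: continuous_in_subspaceT => x; rewrite inE => cx; exact: (cs [::]).
- move=> s s2; exists (iter_derive s (fun y => phi (t, y))); split => //.
  by apply: continuous_in_subspaceT => x; rewrite inE => cx; exact: (cs s).
have [x Ox] := dom_nonempty hD.
rewrite /Ck_norm; set S := (X in sup X).
have S0 : S `|phi (t, x)| by exists [::] => //; exists x.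
suff ubK : ubound S K.
  apply/andP; split; last by apply: ge_sup ubK; exists `|phi (t, x)|.
  by rewrite (le_trans (normr_ge0 (phi (t, x)))) // ub_le_sup //; exists K.
have basis1 (i : 'I_N) : `|((0, basis_vec i) : R * 'rV[R]_N)| <= 1.
  rewrite pair_norm_le normr0 ler01 /=.
  apply: mx_norm_le => // k l; rewrite mxE.
  by case: (_ && _); rewrite ?normr1 ?normr0.
have K0 : 0 <= K by apply: le_trans (normr_ge0 _) (H0 _ (Qt x (subset_closure Ox))).
move=> _ [s /= s2 [z Oz <-]]; rewrite iter_derive_slice.
have Qz := Qt z (subset_closure Oz); have Wz := QW _ Qz.
case: s s2 => [|i [|j [|//]]] _ /=.
- exact: H0.
- by rewrite (le_trans (H1 _ _ Wz)) // ler_piMr.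
- by rewrite (le_trans (H2 _ _ _ Wz)) // -mulrA ler_piMr // mulr_ile1.
Qed.

End TestFunction.

(** * Averages over the branches *)

Section BranchMean.
Context {R : realType} {Np : nat}.
Implicit Types F G : {ffun 'I_Np -> bool} -> R.

Lemma branch_meanD F G :
  branch_mean (fun p => F p + G p) = branch_mean F + branch_mean G.
Proof. by rewrite /branch_mean big_split mulrDr. Qed.

Lemma branch_meanZ c F : branch_mean (fun p => c * F p) = c * branch_mean F.
Proof. by rewrite /branch_mean -mulr_sumr mulrCA. Qed.

Lemma branch_meanB F G :
  branch_mean (fun p => F p - G p) = branch_mean F - branch_mean G.
Proof. by rewrite /branch_mean sumrB mulrBr. Qed.

Lemma branch_mean_cst (c : R) : branch_mean (fun _ : {ffun 'I_Np -> bool} => c) = c.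
Proof.
rewrite /branch_mean sumr_const card_ffun card_bool card_ord.
by rewrite -[c *+ _]mulr_natl natrX mulKf // expf_neq0.
Qed.

Lemma branch_mean_sum (J : finType) (F : J -> {ffun 'I_Np -> bool} -> R) :
  branch_mean (fun p => \sum_j F j p) = \sum_j branch_mean (F j).
Proof. by rewrite /branch_mean exchange_big /= mulr_sumr. Qed.

Lemma branch_mean_le F c : (forall p, `|F p| <= c) -> `|branch_mean F| <= c.
Proof.
move=> H; have P0 : 0 < (2 ^+ Np)^-1 :> R by rewrite invr_gt0 exprn_gt0.
rewrite /branch_mean normrM gtr0_norm // -[leRHS]branch_mean_cst ler_pM2l //.
by rewrite (le_trans (ler_norm_sum _ _ _)) // ler_sum.
Qed.

(** Flipping the j-th sign permutes the branches, so anything odd in that sign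
    has mean zero. *)
Let flip (j : 'I_Np) (p : {ffun 'I_Np -> bool}) : {ffun 'I_Np -> bool} :=
  [ffun l => if l == j then ~~ p l else p l].

Let flipK j : involutive (flip j).
Proof.
by move=> p; apply/ffunP => l; rewrite !ffunE; case: eqP => // _; rewrite negbK.
Qed.

Let branch_mean_odd j F : (forall p, F (flip j p) = - F p) -> branch_mean F = 0.
Proof.
move=> H; rewrite /branch_mean.
suff E : \sum_p F p = - \sum_p F p.
  by rewrite (_ : \sum_p F p = 0) ?mulr0 //; lra.
rewrite {1}(reindex_inj (inv_inj (flipK j))) -sumrN /=.
by apply: eq_bigr => p _; rewrite H.
Qed.

Let sign_flip j p l : sign_vec (flip j p) 0 l =
  (if l == j then -1 else 1) * sign_vec p 0 l :> R.
Proof.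
rewrite !mxE !ffunE; case: eqP => _; rewrite ?mul1r //.
by case: (p l); rewrite /= ?expr0 ?expr1 ?mulN1r ?opprK.
Qed.

Lemma sign_moment1 j :
  branch_mean (fun p : {ffun 'I_Np -> bool} => sign_vec p 0 j : R) = 0.
Proof. by apply: (@branch_mean_odd j) => p; rewrite sign_flip eqxx mulN1r. Qed.

Lemma sign_moment2 j l :
  branch_mean (fun p : {ffun 'I_Np -> bool} =>
    sign_vec p 0 j * sign_vec p 0 l : R) = (j == l)%:R.
Proof.
case: eqP => [<-|/eqP jl].
  rewrite -[RHS]branch_mean_cst; congr branch_mean; apply/funext => p.
  by rewrite mxE; case: (p j); rewrite /= ?expr0 ?expr1 ?mulrNN mulr1.
apply: (@branch_mean_odd j) => p; rewrite !sign_flip eqxx eq_sym (negbTE jl).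
by rewrite mul1r mulN1r mulNr.
Qed.

Lemma sign_vec_le (p : {ffun 'I_Np -> bool}) : `|sign_vec p : 'rV[R]_Np| <= 1.
Proof.
apply: mx_norm_le => // i j; rewrite mxE.
by case: (p j); rewrite /= ?expr0 ?expr1 ?normrN normr1.
Qed.

End BranchMean.

(** * Expansion of the branches *)

Section Expansions.
Context {R : realType} {N Np NA NB : nat}.
Variables (D : control_data R N Np NA NB) (hD : standing D).
Variables (W : set (R * 'rV[R]_N)) (phi : R * 'rV[R]_N -> R).
Hypothesis hphi : test_function D W phi.
Variables (K e M : R).
Hypotheses (K1 : 1 <= K) (e0 : 0 < e) (hK : phi_controls D W phi K e).
Hypotheses (M1 : 1 <= M)
  (hA : forall t x a, closedQA D (t, x, a) ->
     [/\ `|sigma D t x a| <= M, `|mu D t x a| <= M, `|cost_f D t x a| <= M &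
         0 <= rate_r D t x a <= M])
  (hB : forall t x b, lateralB D (t, x, b) ->
     `|cost_g D t x b| <= M /\ 0 <= rate_k D t x b <= M).

Local Notation O := (dom D).
Local Notation A := (ctrlA D).
Local Notation B := (ctrlB D).

(** The parabolic generator of the controlled diffusion, applied to phi. *)
Definition gen (t : R) x a : R :=
  derive1 (fun s : R => phi (s, x)) t
  + dot (mu D t x a) (grad (fun y => phi (t, y)) x)
  + 2^-1 * \tr (sigma D t x a *m (sigma D t x a)^T *m hess (fun y => phi (t, y)) x).

Lemma AopE t x a :
  Aop D phi t x a = - gen t x a + rate_r D t x a * phi (t, x) - cost_f D t x a.
Proof. by rewrite /Aop /Hop /gen; ring. Qed.

(** Bound for a branch displacement in units of the square root of dt. *)
Let L := Np%:R * M + M.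

Let M0 : 0 <= M. Proof. exact: le_trans ler01 M1. Qed.
Let K0 : 0 <= K. Proof. exact: le_trans ler01 K1. Qed.

Let L1 : 1 <= L.
Proof. by rewrite (le_trans M1) // lerDr mulr_ge0. Qed.

Definition noise (t : R) x a (p : {ffun 'I_Np -> bool}) : 'rV[R]_N :=
  sign_vec p *m (sigma D t x a)^T.

Let noise_le0 t x a p : closedQA D (t, x, a) -> `|noise t x a p| <= Np%:R * M.
Proof.
move=> /hA[sM _ _ _].
apply: mx_norm_le => [|i j]; first exact: mulr_ge0.
rewrite mxE (le_trans (ler_norm_sum _ _ _)) //.
apply: (@le_trans _ _ (\sum_(l < Np) M)); last first.
  by rewrite sumr_const card_ord mulr_natl.
apply: ler_sum => l _; rewrite normrM -[leRHS]mul1r ler_pM //.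
  by rewrite ord1 (le_trans (mx_entry_le _ _ _)) // sign_vec_le.
by rewrite mxE (le_trans (mx_entry_le _ _ _)).
Qed.

Let noise_le t x a p : closedQA D (t, x, a) -> `|noise t x a p| <= L.
Proof. by move=> Q; rewrite (le_trans (noise_le0 p Q)) // lerDl. Qed.

Let drift (t : R) x a : R * 'rV[R]_N := (1, mu D t x a).

Let drift_le t x a : closedQA D (t, x, a) -> `|drift t x a| <= L.
Proof.
move=> /hA[_ mM _ _]; rewrite pair_norm_le normr1 L1 /=.
by rewrite (le_trans mM) // lerDr mulr_ge0.
Qed.

Let step_le (s : R) : 0 <= s <= 1 -> Np%:R * M * s + s ^+ 2 * M <= L * s.
Proof.
move=> /andP[s0 s1]; rewrite /L mulrDl lerD2l mulrC ler_wpM2l //.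
by rewrite expr2 ler_piMl.
Qed.

Let XstarB (dt t : R) x a p : Xstar D dt t x a p - x =
  dt *: mu D t x a + Num.sqrt dt *: noise t x a p.
Proof. by rewrite /Xstar -[x + _ + _]addrA [x + _]addrC addrK. Qed.

Let Xstar_dist (dt t : R) x a p : closedQA D (t, x, a) -> 0 < dt ->
  Num.sqrt dt <= 1 -> `|Xstar D dt t x a p - x| <= L * Num.sqrt dt.
Proof.
move=> Q dt0 s1; have s0 : 0 <= Num.sqrt dt by exact: sqrtr_ge0.
apply: le_trans (step_le (s := Num.sqrt dt) _); last by rewrite s0.
rewrite sqr_sqrtr ?(ltW dt0) // XstarB addrC.
rewrite (le_trans (ler_normD _ _)) // lerD //.
  rewrite normrZ ger0_norm // mulrC ler_wpM2r //.
  exact: noise_le0.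
rewrite normrZ gtr0_norm // ler_wpM2l ?(ltW dt0) //.
by have [] := hA Q.
Qed.

Let second_order_noise (dt t : R) x a p (v w : R * 'rV[R]_N) :
  closedQA D (t, x, a) -> 0 < dt -> Num.sqrt dt <= 1 ->
  v = (dt, Xstar D dt t x a p - x) -> w = (0, noise t x a p) ->
  `|'D_v ('D_v phi) (t, x) - dt * 'D_w ('D_w phi) (t, x)|
    <= 3 * K * L ^+ 2 * Num.sqrt dt ^+ 3.
Proof.
move=> Q dt0 s1 vD wD; have [oW QW C3 _] := hphi; have [_ _ _ H2 _] := hK.
have [Qtx Aa] := Q; have Wq := QW _ Qtx.
have C2 : Ck 2 W phi by exact: Ck_le C3.
set s := Num.sqrt dt; have s0 : 0 <= s by exact: sqrtr_ge0.
have sE : s ^+ 2 = dt by rewrite sqr_sqrtr // ltW.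
pose u := drift t x a.
have vE : v = dt *: u + s *: w.
  rewrite vD wD.
  congr pair; rewrite /= ?scaler0 ?addr0; first by rewrite [dt *: _]mulr1.
  by rewrite XstarB.
have outer := @iter_derive_lin2 R _ 2 W phi [:: v] [::] (t, x) dt s u w oW C2 Wq isT.
have inner z := @iter_derive_lin2 R _ 2 W phi [::] [:: z] (t, x) dt s u w oW C2 Wq isT.
rewrite -vE /= in outer.
have inner' z : 'D_z ('D_v phi) (t, x) =
   dt * 'D_z ('D_u phi) (t, x) + s * 'D_z ('D_w phi) (t, x).
  by rewrite vE; exact: inner z.
have uL : `|u| <= L by exact: drift_le.
have wL : `|w| <= L by rewrite wD pair_norm_le normr0 (le_trans ler01 L1) noise_le.
have b y z : `|y| <= L -> `|z| <= L -> `|'D_y ('D_z phi) (t, x)| <= K * L ^+ 2.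
  move=> yL zL; rewrite (le_trans (H2 _ y z Wq)) // -mulrA ler_wpM2l // expr2.
  exact: ler_pM.
rewrite -[3 * K * L ^+ 2]mulrA.
rewrite [dt in dt * _](esym sE).
rewrite -[dt]sE in outer inner'.
have s01 : 0 <= s <= 1 by rewrite s0.
exact: quadratic_remainder_le s01 outer (inner' u) (inner' w) (b u u uL uL)
  (b u w uL wL) (b w u wL uL).
Qed.

(** The signs have covariance the identity, so averaging the Hessian along the
    noise contracts it with sigma sigma^T. *)
Lemma noise_second_moment t x a : closedQA D (t, x, a) ->
  branch_mean (fun p : {ffun 'I_Np -> bool} =>
    'D_((0, noise t x a p) : R * 'rV[R]_N) ('D_(0, noise t x a p) phi) (t, x)) =
  \tr (sigma D t x a *m (sigma D t x a)^T *m hess (fun y => phi (t, y)) x).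
Proof.
move=> [/= Qtx Aa]; have [oW QW C3 _] := hphi; have Wq := QW _ Qtx.
have C2 : Ck 2 W phi by exact: Ck_le C3.
pose H := hess (fun y => phi (t, y)) x; rewrite -/H.
have -> : (fun p => iter_derive [:: (0, noise t x a p); (0, noise t x a p)] phi (t, x)) =
    (fun p => \sum_i \sum_j \sum_l \sum_m
      (sigma D t x a i l * sigma D t x a j m * H i j)
        * (sign_vec p 0 l * sign_vec p 0 m)).
  apply/funext => p; rewrite [LHS](derive2_hess _ oW C2 Wq).
  apply: eq_bigr => i _; apply: eq_bigr => j _.
  rewrite !mxE mulr_suml mulr_suml; apply: eq_bigr => l _.
  rewrite mulr_sumr mulr_suml; apply: eq_bigr => m _.
  by rewrite ![(sigma D t x a)^T _ _]mxE /H mxE; ring.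
rewrite branch_mean_sum /mxtrace.
under [RHS]eq_bigr => j _ do rewrite mxE.
rewrite exchange_big /=; apply: eq_bigr => i _.
rewrite branch_mean_sum; apply: eq_bigr => j _.
rewrite [(sigma D t x a *m _) j i]mxE mulr_suml branch_mean_sum.
apply: eq_bigr => l _.
rewrite branch_mean_sum (bigD1 l) //= branch_meanZ sign_moment2 eqxx mulr1.
rewrite big1 => [|m ml].
  by rewrite addr0 [(sigma D t x a)^T _ _]mxE; ring.
by rewrite branch_meanZ sign_moment2 eq_sym (negbTE ml) mulr0.
Qed.

Lemma gen_bound : exists C : R, forall (t : R) x a, closedQA D (t, x, a) ->
  `|gen t x a| <= C.
Proof.
have [oW QW C3 _] := hphi; have [_ _ H1 H2 _] := hK.
have C1 : Ck 1 W phi by exact: Ck_le C3.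
exists (K + K * M + K * L ^+ 2) => t x a Q.
have [_ mM _ _] := hA Q; have [Qtx _] := Q; have Wq := QW _ Qtx.
rewrite /gen -noise_second_moment //.
rewrite (le_trans (ler_normD _ _)) // lerD //.
  rewrite (le_trans (ler_normD _ _)) // lerD //.
    rewrite derive_time (le_trans (H1 _ _ Wq)) // ler_piMr //.
    by rewrite pair_norm_le normr1 normr0 lexx ler01.
  have := derive_st 0 (mu D t x a) oW C1 Wq; rewrite mul0r add0r => <-.
  rewrite (le_trans (H1 _ _ Wq)) // ler_wpM2l // pair_norm_le normr0 M0.
  exact: mM.
rewrite normrM ger0_norm // (@le_trans _ _ `|branch_mean (fun p : {ffun 'I_Np -> bool} =>
    'D_((0, noise t x a p) : R * 'rV[R]_N) ('D_(0, noise t x a p) phi) (t, x))|) //.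
  by rewrite ler_piMl // invf_le1 // ler1n.
apply: branch_mean_le => p; rewrite (le_trans (H2 _ _ _ Wq)) // -mulrA expr2.
have nL : `|((0, noise t x a p) : R * 'rV[R]_N)| <= L.
  by rewrite pair_norm_le normr0 (le_trans ler01 L1) noise_le.
by rewrite ler_wpM2l // ler_pM.
Qed.

(** Taylor expansion in space-time along (dt, X* - x): in the mean the term of
    order dt^(1/2) vanishes because the signs have mean zero, and only the noise
    part of the quadratic term is not O(dt^(3/2)). *)
Lemma mean_expansion : exists C dt0 : R, 0 < dt0 /\
  forall (dt t : R) x a, 0 < dt <= dt0 -> closedQA D (t, x, a) ->
  `|branch_mean (fun p => phi (t + dt, Xstar D dt t x a p)) - phi (t, x)
     - dt * gen t x a| <= C * Num.sqrt dt ^+ 3.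
Proof.
have [oW QW C3 _] := hphi.
have C1 : Ck 1 W phi by exact: Ck_le C3.
have C2 : Ck 2 W phi by exact: Ck_le C3.
have Lp : 0 < L by exact: lt_le_trans ltr01 L1.
have [dt0 dt00 sm] := @sqrt_small R (e / L) (divr_gt0 e0 Lp).
exists (K * L ^+ 3 + 3 * K * L ^+ 2), dt0; split => // dt t x a dtb Q.
have [s0 se s1 sE] := sm dt dtb; have dtp : 0 < dt by case/andP: dtb.
have [Qtx Aa] := Q; have Wq := QW _ Qtx.
set s := Num.sqrt dt in s0 se s1 sE *.
pose v p : R * 'rV[R]_N := (dt, Xstar D dt t x a p - x).
pose w p : R * 'rV[R]_N := (0, noise t x a p).
have vL p : `|v p| <= L * s.
  rewrite pair_norm_le (Xstar_dist _ Q) // andbT gtr0_norm // -sE expr2.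
  by rewrite ler_wpM2r ?(ltW s0) // (le_trans s1).
have ve p : `|v p| < e by rewrite (le_lt_trans (vL p)) // mulrC -ltr_pdivlMr.
have qv p : (t, x) + v p = (t + dt, Xstar D dt t x a p).
  by congr pair; rewrite /= subrKC.
pose gr := grad (fun y => phi (t, y)) x.
pose dtphi := derive1 (fun r : R => phi (r, x)) t.
have D1 p : 'D_(v p) phi (t, x) =
    dt * dtphi + dt * dot (mu D t x a) gr + s * dot (noise t x a p) gr.
  rewrite (derive_st _ _ oW C1 Wq) -[RHS]addrA; congr (_ + _).
  rewrite /dot !mulr_sumr -big_split /=; apply: eq_bigr => i _.
  by rewrite XstarB -/s mxE [in LHS]mxE [in X in _ + X]mxE; ring.
have mean1 : branch_mean (fun p => dot (noise t x a p) gr) = 0.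
  rewrite branch_mean_sum big1 // => i _.
  have -> : (fun p => noise t x a p 0 i * gr 0 i) =
      (fun p => \sum_l (sigma D t x a i l * gr 0 i) * sign_vec p 0 l).
    apply/funext => p; rewrite mxE mulr_suml; apply: eq_bigr => l _.
    by rewrite [(sigma D t x a)^T _ _]mxE; ring.
  rewrite branch_mean_sum big1 // => l _.
  by rewrite branch_meanZ sign_moment1 mulr0.
pose H := hess (fun y => phi (t, y)) x.
have mean2 := noise_second_moment Q; rewrite -/H in mean2.
have -> : branch_mean (fun p => phi (t + dt, Xstar D dt t x a p)) - phi (t, x)
     - dt * gen t x a = branch_mean (fun p => phi ((t, x) + v p) - phi (t, x)
       - 'D_(v p) phi (t, x) - 2^-1 * (dt * 'D_(w p) ('D_(w p) phi) (t, x))).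
  rewrite !branch_meanB branch_mean_cst !branch_meanZ mean2.
  rewrite (funext D1) (funext (fun p => congr1 phi (qv p))).
  rewrite branch_meanD branch_mean_cst branch_meanZ mean1 mulr0 addr0.
  by rewrite /gen -/dtphi -/gr -/H; ring.
apply: branch_mean_le => p.
have T3 := phi_taylor3 hphi hK Qtx (ve p).
have S := second_order_noise Q dtp s1 (erefl (v p)) (erefl (w p)).
have T3' : K * `|v p| ^+ 3 <= K * L ^+ 3 * s ^+ 3.
  rewrite -mulrA -exprMn ler_wpM2l // lerXn2r ?nnegrE //.
  by rewrite mulr_ge0 // ltW.
rewrite mulrDl; apply: half_remainder_le (le_trans T3 T3') S.
Qed.

(** A branch that does not exit satisfies the expansion exactly, all corrections
    being zero; an exiting one reduces to reflection_expansion, whose two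
    hypotheses on phi come from Taylor expansions at the boundary point y. *)
Lemma branch_expansion : exists C dt0 : R, 0 < dt0 /\
  forall (dt t : R) x a b (p : {ffun 'I_Np -> bool}), 0 < dt <= dt0 ->
  times D t -> times D (t + dt) -> O x -> A a -> B b ->
  let s := Num.sqrt dt in
  let d := dtil D dt t x a b p in let k := ktil D dt t x a b p in
  let g := gtil D dt t x a b p in
  [/\ closure O (Xtil D dt t x a b p), 0 <= d <= C * s, 0 <= k,
      `|Ltil D dt t x a b p phi| <= C /\ `|Rtil D dt t x a b p phi| <= C &
      `|expR (- (k * d)) * phi (t + dt, Xtil D dt t x a b p)
         + d * expR (- (k * d / 2)) * g
         - (phi (t + dt, Xstar D dt t x a p) - d * Ltil D dt t x a b p phi
            + d ^+ 2 * Rtil D dt t x a b p phi)| <= C * s ^+ 3].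
Proof.
have [oW QW C3 _] := hphi; have [_ H0 H1 _ _] := hK.
have C1 : Ck 1 W phi by exact: Ck_le C3.
have [Kg [eg [Kg0 eg0 geo]]] := exit_geometry hD.
have Lp : 0 < L by exact: lt_le_trans ltr01 L1.
have [w1 w10 w1E] : exists2 w : R, 0 < w & w = Kg * L.
  by exists (Kg * L); rewrite ?mulr_gt0.
have [K0' M0'] : 0 <= K /\ 0 <= M by [].
have w1' := ltW w10.
pose r := Num.min (eg / L) (e / (1 + w1)).
have r0 : 0 < r by rewrite lt_min !divr_gt0 // addr_gt0.
have [dt0 dt00 sm] := @sqrt_small R r r0.
(* c0 dominates every constant that reflection_expansion asks for. *)
pose c0 := 1 + M + K + 2 * w1 + (2 * K * w1 ^+ 3 + 2 * K * w1) + (K * (1 + w1) ^+ 2 + K).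
have w4 : 0 <= 1 + w1 by exact: addr_ge0.
have w2 : 0 <= K * w1 ^+ 3 by apply: mulr_ge0 => //; exact: exprn_ge0.
have w3 : 0 <= K * w1 by exact: mulr_ge0.
have Kw : 0 <= K * (1 + w1) ^+ 2 by apply: mulr_ge0 => //; exact: exprn_ge0.
have [c01 Mc0 Kc0 wc0] : [/\ 1 <= c0, M <= c0, K <= c0 & 2 * w1 <= c0].
  by rewrite /c0; split; lra.
have [q1 q2] : 2 * K * w1 ^+ 3 + 2 * K * w1 <= c0 /\ K * (1 + w1) ^+ 2 + K <= c0.
  by rewrite /c0; split; lra.
have [C' refl] := reflection_expansion c01.
pose C := `|C'| + c0 + (K + M * K + M) + (M ^+ 2 * K + M ^+ 2 + M * K).
have MK : 0 <= M * K by rewrite mulr_ge0.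
have M2 : 0 <= M ^+ 2 by rewrite exprn_ge0.
have M2K : 0 <= M ^+ 2 * K by rewrite mulr_ge0.
have C'C : `|C'| <= C by have := normr_ge0 C'; rewrite /C; lra.
have Cc0 : c0 <= C by have := normr_ge0 C'; rewrite /C; lra.
have [lC rC] : K + M * K + M <= C /\ M ^+ 2 * K + M ^+ 2 + M * K <= C.
  by have := normr_ge0 C'; rewrite /C; split; lra.
have C0 : 0 <= C by lra.
exists C, dt0; split => // dt t x a b p dtb Tt Tt' Ox Aa Bb s d k g.
have [s0 sr s1 sE] := sm dt dtb; have dtp : 0 < dt by case/andP: dtb.
rewrite -/s in s0 sr s1 sE.
have s0' := ltW s0.
have cx : closure O x by exact: subset_closure.
have Q : closedQA D (t, x, a) by [].
have XL := Xstar_dist p Q dtp s1; rewrite -/s in XL.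
have s3 : 0 <= s ^+ 3 by rewrite exprn_ge0.
rewrite /d /k /g /dtil /ktil /gtil /Xtil /Ltil /Rtil /dtil.
case: ifPn => [ex|]; last first.
  rewrite /exiting negbK inE => cX.
  split => //; [by rewrite lexx mulr_ge0|by rewrite normr0|].
  rewrite !(mul0r, mulr0) !oppr0 expR0 mul1r !addr0 subrr normr0.
  by rewrite mulr_ge0.
move: (ex); rewrite /exiting notin_setE => nX; rewrite ?ex.
have Xe : `|Xstar D dt t x a p - x| < eg.
  apply: (le_lt_trans XL); rewrite mulrC -ltr_pdivlMr //.
  by rewrite (lt_le_trans sr) // ge_min lexx.
have := geo x _ b Ox nX Bb Xe; rewrite -/(xb D dt t x a b p).
set y := xb D dt t x a b p; set X := Xstar D dt t x a p.
set w := proj_dist D X b => -[Oy XE wp wK Oyw].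
have w0 := ltW wp.
have ws : w <= w1 * s.
  by rewrite (le_trans wK) // w1E -mulrA ler_wpM2l // ltW.
have cy : closure O y by case: Oy.
have Qy : closedQ D (t, y) by [].
have Qy' : closedQ D (t + dt, y) by [].
have Wy := QW _ Qy; have Wy' := QW _ Qy'.
have [gM /andP[k0 kM]] : `|cost_g D t y b| <= M /\ 0 <= rate_k D t y b <= M.
  by apply: hB; split.
have gm1 := gam_norm_le hD Oy Bb.
set gm := gam D y b in gm1 XE Oyw *.
pose gp := dot gm (grad (fun z => phi (t, z)) y).
have gpE : 'D_((0, gm) : R * 'rV[R]_N) phi (t, y) = gp.
  by rewrite (derive_st _ _ oW C1 Wy) mul0r add0r.
have gmn : `|((0, gm) : R * 'rV[R]_N)| <= 1 by rewrite pair_norm_le normr0 ler01.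
have gpK : `|gp| <= K by rewrite -gpE (le_trans (H1 _ _ Wy)) // ler_piMr.
have zK : `|phi (t, y)| <= K by exact: H0.
have XtE : X - (2 * w) *: gm = y - w *: gm.
  by rewrite [in LHS]XE mulr_natl mulr2n scalerDl opprD addrA addrK.
rewrite -/X (_ : X \notin closure O) ?XtE; last by rewrite notin_setE.
have FtK : `|phi (t + dt, y - w *: gm)| <= K.
  by apply: H0; split => //=; exact: subset_closure.
have se : (1 + w1) * s < e.
  rewrite mulrC -ltr_pdivlMr ?ltr_pwDl //.
  by rewrite (lt_le_trans sr) // ge_min lexx orbT.
have we : w < e.
  by rewrite (le_lt_trans ws) // (le_lt_trans _ se) // ler_wpM2r // lerDr.
have dts : dt <= s by rewrite -sE expr2 ler_piMl.
have dte : dt < e.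
  rewrite (le_lt_trans dts) // (le_lt_trans _ se) //.
  by rewrite ler_peMl // lerDl.
pose v : R * 'rV[R]_N := (0, w *: gm).
have vw : `|v| <= w.
  by rewrite pair_norm_le normr0 w0 /= normrZ ger0_norm // ler_piMr.
(* phi is expanded at (t + dt, y), where the two points are symmetric; moving
   its oblique derivative back to time t costs O(d dt). *)
have e3 : `|phi (t + dt, X) - phi (t + dt, y - w *: gm) - (2 * w) * gp|
    <= c0 * s ^+ 3.
  have S := phi_symmetric_difference hphi hK Qy' (le_lt_trans vw we).
  have T := @derive_phi_taylor1 _ _ _ _ _ _ _ _ hphi _ _ hK (t, y) (0, gm) (dt, 0) Qy.
  have qE : (t, y) + (dt, 0) = (t + dt, y) :> R * 'rV[R]_N.
    by congr pair; rewrite /= addr0.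
  rewrite qE gpE in T.
  have vp : (t + dt, y) + v = (t + dt, X) :> R * 'rV[R]_N.
    by rewrite XE; congr pair; rewrite /= addr0.
  have vm : (t + dt, y) - v = (t + dt, y - w *: gm) :> R * 'rV[R]_N.
    by congr pair; rewrite /= oppr0 addr0.
  rewrite vp vm in S.
  have vE : v = w *: (0, gm) by congr pair; rewrite /= scaler0.
  rewrite {1}vE deriveZ_dir in S; last exact: Ck1_derivable C1 Wy'.
  have dtn : `|((dt, 0) : R * 'rV[R]_N)| <= dt.
    by rewrite pair_norm_le normr0 gtr0_norm // lexx ltW.
  have {}T := T (le_lt_trans dtn dte).
  have T' : K * `|((0, gm) : R * 'rV[R]_N)| * `|((dt, 0) : R * 'rV[R]_N)| <= K * s ^+ 2.
    by rewrite ler_pM ?mulr_ge0 // ?sE // ler_piMr.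
  have S' : 2 * K * `|v| ^+ 3 <= 2 * K * w1 ^+ 3 * s ^+ 3.
    rewrite -[leRHS]mulrA ler_wpM2l ?mulr_ge0 // -exprMn lerXn2r ?nnegrE //.
      by rewrite mulr_ge0.
    exact: le_trans vw ws.
  have {}S := le_trans S S'; have {}T := le_trans T T'.
  have T2 : `|2 * w * ('D_((0, gm) : R * 'rV[R]_N) phi (t + dt, y) - gp)|
      <= 2 * K * w1 * s ^+ 3.
    rewrite normrM ger0_norm ?mulr_ge0 //.
    rewrite (_ : 2 * K * w1 * s ^+ 3 = (2 * (w1 * s)) * (K * s ^+ 2)); last by ring.
    by rewrite ler_pM // ?mulr_ge0 // ler_wpM2l.
  rewrite (_ : _ - _ - _ = (phi (t + dt, X) - phi (t + dt, y - w *: gm)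
     - 2 * (w * 'D_((0, gm) : R * 'rV[R]_N) phi (t + dt, y))) +
     2 * w * ('D_((0, gm) : R * 'rV[R]_N) phi (t + dt, y) - gp)); last by ring.
  rewrite (le_trans (ler_normD _ _)) // (le_trans (lerD S T2)) //.
  by rewrite -mulrDl ler_wpM2r.
have e2 : `|phi (t + dt, y - w *: gm) - phi (t, y) + 2 * w / 2 * gp|
    <= c0 * s ^+ 2.
  pose u : R * 'rV[R]_N := (dt, - (w *: gm)).
  have us : `|u| <= (1 + w1) * s.
    rewrite pair_norm_le gtr0_norm // mulrDl mul1r; apply/andP; split.
      by rewrite (le_trans dts) // lerDl mulr_ge0.
    rewrite normrN normrZ ger0_norm // (@le_trans _ _ w) ?ler_piMr //.
    by rewrite (le_trans ws) // lerDr.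
  have S := phi_taylor2 hphi hK Qy (le_lt_trans us se).
  have uE : (t, y) + u = (t + dt, y - w *: gm) by [].
  have Du : 'D_u phi (t, y) =
      dt * 'D_((1, 0) : R * 'rV[R]_N) phi (t, y) - w * gp.
    rewrite (derive_st _ _ oW C1 Wy) derive_time /gp; congr (_ + _).
    rewrite /dot mulr_sumr -sumrN; apply: eq_bigr => i _.
    by rewrite [in LHS]mxE [in LHS]mxE mulNr mulrA.
  rewrite uE Du in S.
  have S' : K * `|u| ^+ 2 <= K * (1 + w1) ^+ 2 * s ^+ 2.
    rewrite -mulrA ler_wpM2l // -exprMn lerXn2r ?nnegrE //.
    by rewrite mulr_ge0.
  have {}S := le_trans S S'.
  have T : `|dt * 'D_((1, 0) : R * 'rV[R]_N) phi (t, y)| <= K * s ^+ 2.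
    rewrite normrM gtr0_norm // sE mulrC ler_wpM2r ?(ltW dtp) //.
    rewrite (le_trans (H1 _ _ Wy)) // ler_piMr // pair_norm_le normr1 normr0.
    by rewrite lexx ler01.
  rewrite (_ : _ + _ = (phi (t + dt, y - w *: gm) - phi (t, y)
     - (dt * 'D_((1, 0) : R * 'rV[R]_N) phi (t, y) - w * gp)) +
     dt * 'D_((1, 0) : R * 'rV[R]_N) phi (t, y)); last by field.
  rewrite (le_trans (ler_normD _ _)) // (le_trans (lerD S T)) //.
  by rewrite -mulrDl ler_wpM2r ?exprn_ge0.
have c0s : 0 <= 2 * w <= c0 * s.
  rewrite mulr_ge0 //= (@le_trans _ _ (2 * w1 * s)) //.
    by rewrite -mulrA ler_wpM2l.
  by rewrite ler_wpM2r.
have gpE' : dot (gam D y b) (grad (fun z => phi (t, z)) y) = gp by [].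
have kz : `|rate_k D t y b * phi (t, y)| <= M * K.
  by rewrite normrM ler_pM // ger0_norm.
split.
- exact: subset_closure.
- case/andP: c0s => -> /le_trans; apply; exact: ler_wpM2r.
- exact: k0.
- split.
  rewrite /Lop gpE' (le_trans (ler_normB _ _)) // (@le_trans _ _ (K + M * K + M)) //.
    by rewrite lerD // (le_trans (ler_normD _ _)) // lerD.
  rewrite /Rop gpE'; set kk := rate_k D t y b in k0 kM kz *.
  set gg := cost_g D t y b in gM *.
  have b1 : `|2^-1 * kk ^+ 2 * phi (t, y)| <= M ^+ 2 * K.
    rewrite normrM ler_pM // ger0_norm ?mulr_ge0 ?sqr_ge0 //.
    rewrite (@le_trans _ _ (kk ^+ 2)) ?lerXn2r ?nnegrE //.
    by rewrite ler_piMl ?sqr_ge0 // invf_le1 // ler1n.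
  have k2 : `|2^-1 * kk| <= M.
    rewrite ger0_norm ?mulr_ge0 // (le_trans _ kM) // ler_piMl //.
    by rewrite invf_le1 // ler1n.
  have b2 : `|2^-1 * kk * gg| <= M ^+ 2 by rewrite normrM expr2 ler_pM.
  have b3 : `|2^-1 * kk * gp| <= M * K by rewrite normrM ler_pM.
  rewrite (le_trans (ler_normD _ _)) // (le_trans _ rC) //.
    by rewrite lerD // (le_trans (ler_normB _ _)) // lerD.
- rewrite /Lop /Rop gpE'.
  apply: (le_trans (refl s (rate_k D t y b) (2 * w) (cost_g D t y b) (phi (t, y))
    gp (phi (t + dt, X)) (phi (t + dt, y - w *: gm)) _ _ _ _ _ _ _ _)) => //.
  + by rewrite s0'.
  + by rewrite k0 (le_trans kM).
  + exact: le_trans gM _.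
  + exact: le_trans gpK _.
  + exact: le_trans FtK _.
  + by rewrite ler_wpM2r // (le_trans (ler_norm _)).
Qed.

End Expansions.

(** * Consistency of the scheme *)

(** Passes a uniform expansion of F to its infimum.  Boundedness of G is what
    makes the supremum, hence the infimum, a genuine one. *)
Lemma inf_sup_perturbation (R : realType) (T : Type) (P : set T) (F G : T -> R)
    (c l E C : R) : P !=set0 -> 0 < l -> (forall i, P i -> `|G i| <= C) ->
  (forall i, P i -> `|F i - c + l * G i| <= E) ->
  `|inf (F @` P) - c + l * sup (G @` P)| <= E.
Proof.
move=> [i0 Pi0] l0 bG H.
have supG : has_sup (G @` P).
  split; first by exists (G i0), i0.
  by exists C => _ [i Pi <-]; rewrite (le_trans (ler_norm _)) // bG.
have lbF : lbound (F @` P) (c - l * sup (G @` P) - E).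
  move=> _ [i Pi <-]; have := H i Pi; rewrite ler_norml => /andP[+ _].
  have : l * G i <= l * sup (G @` P).
    apply: ler_wpM2l; first exact: ltW.
    by apply: sup_upper_bound => //; exists i.
  by lra.
have infF : has_inf (F @` P).
  by split; [exists (F i0), i0|eexists; exact: lbF].
have lo : c - l * sup (G @` P) - E <= inf (F @` P).
  by apply: lb_le_inf => //; exists (F i0), i0.
have hi : sup (G @` P) <= (c + E - inf (F @` P)) / l.
  apply: ge_sup; first by exists (G i0), i0.
  move=> _ [i Pi <-]; rewrite ler_pdivlMr //.
  have : inf (F @` P) <= F i by apply: inf_lbound; [exact: infF.2|exists i].
  by have := H i Pi; rewrite ler_norml => /andP[_]; lra.
move: hi; rewrite ler_pdivlMr // => hi.
by rewrite ler_norml; apply/andP; split; lra.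
Qed.

Lemma image2_prod (T1 T2 U : Type) (P : set T1) (Q : set T2) (f : T1 -> T2 -> U) :
  [set f a b | a in P & b in Q] = (fun q => f q.1 q.2) @` (P `*` Q).
Proof.
apply/seteqP; split => u /=.
  by move=> [a Pa [b Qb <-]]; exists (a, b).
by move=> [[a b] [/= Pa Qb] <-]; exists a => //; exists b.
Qed.

Section Consistency.
Context {R : realType} {N Np NA NB : nat}.
Variables (D : control_data R N Np NA NB) (hD : standing D).
Variables (W : set (R * 'rV[R]_N)) (phi : R * 'rV[R]_N -> R).
Hypothesis hphi : test_function D W phi.

Local Notation O := (dom D).
Local Notation A := (ctrlA D).
Local Notation B := (ctrlB D).

(** I stands for the interpolant at time t + dt and eta for its accuracy, which
    keeps the mesh out of the argument: eta enters the estimate unamplified since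
    the exponential weights and the discount factor are at most one. *)
Lemma interior_consistency : exists C dt0 : R, 0 < dt0 /\
  forall (dt t eta : R) (I : 'rV[R]_N -> R) x a b, 0 < dt <= dt0 ->
  times D t -> times D (t + dt) -> O x -> A a -> B b ->
  (forall y, closure O y -> `|I y - phi (t + dt, y)| <= eta) ->
  let dL := branch_mean (fun p => dtil D dt t x a b p * Ltil D dt t x a b p phi) in
  let dR := branch_mean (fun p => dtil D dt t x a b p ^+ 2 * Rtil D dt t x a b p phi) in
  let S := branch_mean (fun p =>
      expR (- (ktil D dt t x a b p * dtil D dt t x a b p)) * I (Xtil D dt t x a b p)
      + dtil D dt t x a b p * expR (- (ktil D dt t x a b p * dtil D dt t x a b p / 2))
        * gtil D dt t x a b p) in
  `|(1 + rate_r D t x a * dt)^-1 * S + dt * cost_f D t x a - phi (t, x)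
    - (- (dt * Aop D phi t x a) - dL + dR)| <= C * Num.sqrt dt ^+ 3 + eta /\
  `|dt * Aop D phi t x a + dL - dR| <= C.
Proof.
have [K [e [K1 e0 hK]]] := phi_controlled hD hphi.
have [M M1 [hA hB]] := data_bound hD.
have [Cg Hg] := gen_bound hphi K1 hK M1 hA.
have [Cm [dt1 [dt1p Hm]]] := mean_expansion hphi K1 e0 hK M1 hA.
have [Cb [dt2 [dt2p Hb]]] := branch_expansion hD hphi K1 e0 hK M1 hA hB.
have [dt3 dt3p sm] := @sqrt_small R 1 ltr01.
pose Cl := Cb ^+ 2; pose Cr := Cb ^+ 3.
pose C1 := M ^+ 2 * K + M * (Cg + Cl + Cr) + (Cb + Cm).
pose C2 := Cg + M * K + M + Cl + Cr.
exists (`|C1| + `|C2|), (Num.min dt1 (Num.min dt2 dt3)).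
split; first by rewrite !lt_min dt1p dt2p.
move=> dt t eta I x a b /andP[dt0]; rewrite !le_min => /and3P[dtb1 dtb2 dtb3].
move=> Tt Tt' Ox Aa Bb HI dL dR S.
have [s0 _ s1 sE] : [/\ 0 < Num.sqrt dt, Num.sqrt dt < 1, Num.sqrt dt <= 1 &
   Num.sqrt dt ^+ 2 = dt] by apply: sm; rewrite dt0.
set s := Num.sqrt dt in s0 s1 sE *.
have s0' := ltW s0.
have cx : closure O x by exact: subset_closure.
have Q : closedQA D (t, x, a) by [].
have {}Hg := Hg t x a Q.
have {Hm} := Hm dt t x a; rewrite dt0 dtb1 => /(_ isT Q).
set Ss := branch_mean _ => Hm; rewrite -/s in Hm.
have dtb : 0 < dt <= dt2 by rewrite dt0.
have {}Hb p := Hb dt t x a b p dtb Tt Tt' Ox Aa Bb.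
have [_ _ _ [Lb Rb] _] := Hb [ffun=> true].
have Cb0 : 0 <= Cb by apply: le_trans (normr_ge0 _) Lb.
have dLb : `|dL| <= Cl * s.
  apply: branch_mean_le => p; have [_ /andP[d0 dC] _ [Lp _] _] := Hb p.
  by rewrite /Cl expr2 mulrAC normrM (ger0_norm d0) ler_pM.
have dRb : `|dR| <= Cr * s.
  apply: branch_mean_le => p; have [_ /andP[d0 dC] _ [_ Rp] _] := Hb p.
  rewrite (_ : Cr * s = Cb ^+ 2 * s * Cb) ; last by rewrite /Cr; ring.
  rewrite normrM; apply: ler_pM => //; rewrite ger0_norm ?sqr_ge0 //.
  rewrite (@le_trans _ _ ((Cb * s) ^+ 2)) //.
    by rewrite lerXn2r ?nnegrE // mulr_ge0.
  by rewrite exprMn ler_wpM2l ?sqr_ge0 // expr2 ler_piMl.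
have HS : `|S - (Ss - dL + dR)| <= eta + Cb * s ^+ 3.
  rewrite /S /Ss /dL /dR -branch_meanB -branch_meanD -branch_meanB.
  apply: branch_mean_le => p; have [cX /andP[d0 dC] k0 _ E] := Hb p.
  set ek := expR (- (ktil D dt t x a b p * dtil D dt t x a b p)) in E *.
  have ek1 : `|ek| <= 1.
    by rewrite ger0_norm ?expR_ge0 // /ek -expR0 ler_expR oppr_le0 mulr_ge0.
  set u := (X in `|X| <= _) in E.
  rewrite (_ : _ - _ = ek * (I (Xtil D dt t x a b p)
    - phi (t + dt, Xtil D dt t x a b p)) + u).
    rewrite (le_trans (ler_normD _ _)) // lerD // normrM -[leRHS]mul1r ler_pM //.
    exact: HI.
  by rewrite /u; ring.
have [_ _ fM /andP[r0 rM]] := hA _ _ _ Q.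
have zK : `|phi (t, x)| <= K by have [_ + _ _ _] := hK; apply.
set z := phi (t, x) in zK Hm *; set G := gen D phi t x a in Hg Hm.
set r := rate_r D t x a in r0 rM *; set f := cost_f D t x a in fM *.
have AE : Aop D phi t x a = - G + r * z - f by rewrite AopE.
rewrite AE.
have dts : dt <= s by rewrite -sE expr2 ler_piMl.
have dtG : `|dt * G| <= Cg * s.
  by rewrite normrM gtr0_norm // mulrC ler_pM // ltW.
pose m := dt * G - dL + dR; pose y := S - (z + m).
have mb : `|m| <= (Cg + Cl + Cr) * s.
  rewrite !mulrDl (le_trans (ler_normD _ _)) // lerD //.
  by rewrite (le_trans (ler_normB _ _)) // lerD.
have yb : `|y| <= eta + (Cb + Cm) * s ^+ 3.
  rewrite (_ : y = (S - (Ss - dL + dR)) + (Ss - z - dt * G)); last first.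
    by rewrite /y /m; ring.
  by rewrite mulrDl [leRHS]addrA (le_trans (ler_normD _ _)) // lerD.
have u0 : 0 <= r * dt by rewrite mulr_ge0 // ltW.
have uM : r * dt <= M * s ^+ 2 by rewrite sE ler_wpM2r // ltW.
have s3 : 0 <= s ^+ 3 by rewrite exprn_ge0.
split.
  rewrite (_ : _ - _ = (1 + r * dt)^-1 * (z + m + y) - (z + m - r * dt * z)); last first.
    by rewrite /y [z + m + _]addrC subrK /m; ring.
  apply: (le_trans (discount_expansion z m y u0)).
  have B1 : (r * dt) ^+ 2 * `|z| <= M ^+ 2 * K * s ^+ 3.
    rewrite [leRHS]mulrAC; apply: ler_pM => //; first exact: exprn_ge0.
    rewrite (@le_trans _ _ ((M * s ^+ 2) ^+ 2)) ?lerXn2r ?nnegrE //.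
      exact: le_trans u0 uM.
    rewrite exprMn ler_wpM2l ?sqr_ge0 //.
    by rewrite (_ : (s ^+ 2) ^+ 2 = s ^+ 3 * s) ?ler_piMr //; ring.
  have B2 : r * dt * `|m| <= M * (Cg + Cl + Cr) * s ^+ 3.
    rewrite (_ : _ * s ^+ 3 = (M * s ^+ 2) * ((Cg + Cl + Cr) * s)); last by ring.
    exact: ler_pM.
  apply: (le_trans (lerD (lerD B1 B2) yb)).
  rewrite addrCA addrC lerD2r -!mulrDl ler_wpM2r //.
  by rewrite -/C1 (le_trans (ler_norm _)) // lerDl.
have B3 : `|dt * (- G + r * z - f)| <= Cg + M * K + M.
  rewrite normrM gtr0_norm // (@le_trans _ _ `|- G + r * z - f|) //.
    by rewrite ler_piMl // (le_trans dts).
  rewrite (le_trans (ler_normB _ _)) // lerD // (le_trans (ler_normD _ _)) //.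
  by rewrite normrN lerD // normrM ler_pM // ger0_norm.
rewrite (@le_trans _ _ C2) //; last by rewrite (le_trans (ler_norm _)) // lerDr.
rewrite (le_trans (ler_normB _ _)) // lerD //; last first.
  by rewrite (le_trans dRb) // ler_piMr // exprn_ge0.
rewrite (le_trans (ler_normD _ _)) // lerD //.
by rewrite (le_trans dLb) // ler_piMr // exprn_ge0.
Qed.

(** The same computation with one step of length l along -gamma in place of the
    diffusion: discounting by 1 / (1 + l k) supplies the term k phi of the
    boundary operator. *)
Lemma boundary_consistency : exists C l0 : R, 0 < l0 /\
  forall (t l eta : R) (I : 'rV[R]_N -> R) x b, 0 < l < l0 ->
  times D t -> boundary O x -> B b ->
  (forall y, closure O y -> `|I y - phi (t, y)| <= eta) ->
  let Lb := Lop D t x (grad (fun y => phi (t, y)) x) (phi (t, x)) b in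
  `|(I (x - l *: gam D x b) + l * cost_g D t x b) / (1 + l * rate_k D t x b)
    - phi (t, x) + l * Lb| <= C * l ^+ 2 + eta /\ `|Lb| <= C.
Proof.
have [K [e [K1 e0 hK]]] := phi_controlled hD hphi.
have [M M1 [_ hB]] := data_bound hD.
have [s0 s00 ray] := oblique_ray hD.
have [oW QW C3 _] := hphi; have [_ H0 H1 _ _] := hK.
have C1 : Ck 1 W phi by exact: Ck_le C3.
pose Cm := K + M; pose C := M ^+ 2 * K + M * Cm + K; pose C' := K + M * K + M.
exists (`|C| + `|C'|), (Num.min s0 e); split; first by rewrite lt_min s00.
move=> t l eta I x b /andP[l0]; rewrite lt_min => /andP[ls le] Tt Ox Bb HI Lb.
have l0' := ltW l0.
have cx : closure O x by case: Ox.
have Qx : closedQ D (t, x) by [].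
have Wx := QW _ Qx.
have [gM /andP[k0 kM]] : `|cost_g D t x b| <= M /\ 0 <= rate_k D t x b <= M.
  by apply: hB; split.
have gm1 := gam_norm_le hD Ox Bb.
set gm := gam D x b in gm1 *; set g := cost_g D t x b in gM *.
set k := rate_k D t x b in k0 kM *.
pose gp := dot gm (grad (fun z => phi (t, z)) x).
have gpE : 'D_((0, gm) : R * 'rV[R]_N) phi (t, x) = gp.
  by rewrite (derive_st _ _ oW C1 Wx) mul0r add0r.
have gpK : `|gp| <= K.
  rewrite -gpE (le_trans (H1 _ _ Wx)) // ler_piMr ?(le_trans ler01) //.
  by rewrite pair_norm_le normr0 ler01.
have zK : `|phi (t, x)| <= K by exact: H0.
set z := phi (t, x) in zK *.
have LbE : Lb = gp + k * z - g by [].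
pose v : R * 'rV[R]_N := (0, - (l *: gm)).
have vl : `|v| <= l.
  by rewrite pair_norm_le normr0 l0' /= normrN normrZ gtr0_norm // ler_piMr.
have T := phi_taylor2 hphi hK Qx (le_lt_trans vl le).
have vE : v = (- l) *: (0, gm) by congr pair; rewrite /= ?scaler0 ?scaleNr.
have xv : (t, x) + v = (t, x - l *: gm) :> R * 'rV[R]_N.
  by congr pair; rewrite /= addr0.
rewrite {2}vE deriveZ_dir in T; last exact: Ck1_derivable C1 Wx.
rewrite xv gpE -/z in T.
have {}T : `|phi (t, x - l *: gm) - z - - l * gp| <= K * l ^+ 2.
  apply: le_trans T _; rewrite ler_wpM2l ?(le_trans ler01) //.
  by rewrite lerXn2r ?nnegrE.
have cX : closure O (x - l *: gm).
  by apply: subset_closure; have [|] := ray x b l Ox Bb; rewrite // l0.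
have {}HI := HI _ cX.
pose m := - l * gp + l * g.
pose y := I (x - l *: gm) + l * g - (z + m).
have yb : `|y| <= K * l ^+ 2 + eta.
  rewrite (_ : y = (phi (t, x - l *: gm) - z - - l * gp) +
    (I (x - l *: gm) - phi (t, x - l *: gm))); last by rewrite /y /m; ring.
  by rewrite (le_trans (ler_normD _ _)) // lerD.
have mb : `|m| <= Cm * l.
  rewrite mulrDl (le_trans (ler_normD _ _)) // lerD //.
    by rewrite normrM normrN (gtr0_norm l0) [leRHS]mulrC ler_wpM2l.
  by rewrite normrM (gtr0_norm l0) [leRHS]mulrC ler_wpM2l.
have u0 : 0 <= l * k by rewrite mulr_ge0.
have uM : l * k <= M * l by rewrite [leRHS]mulrC ler_wpM2l.
have Mp : 0 <= M by exact: le_trans ler01 M1.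
split.
  rewrite LbE (_ : _ + _ = (1 + l * k)^-1 * (z + m + y) - (z + m - l * k * z)); last first.
    by rewrite /y [z + m + _]addrC subrK /m; ring.
  apply: (le_trans (discount_expansion z m y u0)).
  have B1 : (l * k) ^+ 2 * `|z| <= M ^+ 2 * K * l ^+ 2.
    rewrite [leRHS]mulrAC -exprMn; apply: ler_pM => //; first exact: exprn_ge0.
    rewrite lerXn2r ?nnegrE //.
    exact: mulr_ge0.
  have B2 : l * k * `|m| <= M * Cm * l ^+ 2.
    rewrite (_ : _ * l ^+ 2 = (M * l) * (Cm * l)); last by ring.
    exact: ler_pM.
  apply: (le_trans (lerD (lerD B1 B2) yb)).
  rewrite addrA lerD2r -!mulrDl ler_wpM2r ?exprn_ge0 //.
  by rewrite -/C (le_trans (ler_norm _)) // lerDl.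
rewrite LbE (@le_trans _ _ C') //; last by rewrite (le_trans (ler_norm _)) // lerDr.
rewrite (le_trans (ler_normB _ _)) // lerD // (le_trans (ler_normD _ _)) //.
by rewrite lerD // normrM ler_pM // ger0_norm.
Qed.

End Consistency.
Unset Implicit Arguments.

Theorem proposition4p2 (R : realType) (N Np NA NB : nat)
    (D : control_data R N Np NA NB) (hD : standing D)
    (Hs : set R) (Mh : R -> mesh R N) (hM : mesh_family (dom D) Hs Mh)
    (c0 c1 : R) (hc0 : 0 < c0) (hc01 : c0 <= c1)
    (ell : R -> R)
    (hell : forall h, Hs h -> c0 * h <= ell h <= c1 * h)
    (W : set (R * 'rV[R]_N)) (phi : R * 'rV[R]_N -> R)
    (hphi : test_function D W phi) :
  exists C dt0 h0 : R, [/\ 0 < dt0, 0 < h0 &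
    forall (NT : nat) (h : R), (0 < NT)%N -> Hs h ->
    forall dt : R, dt = horizon D / NT%:R -> dt <= dt0 -> h <= h0 ->
    forall n : nat, (n < NT)%N ->
    let t := n%:R * dt in
    let t' := n.+1%:R * dt in
    let grid s := fun j : 'I_(nverts (Mh h)) => phi (s, vert j) in
    (forall i : 'I_(nverts (Mh h)), dom D (vert i) ->
      let x := vert i in
      (forall a b, ctrlA D a -> ctrlB D b ->
        `| (Sint D dt t i (grid t') a b - phi (t, x))
           - (- (dt * Aop D phi t x a)
              - branch_mean (fun p =>
                  dtil D dt t x a b p * Ltil D dt t x a b p phi)
              + branch_mean (fun p =>
                  dtil D dt t x a b p ^+ 2 * Rtil D dt t x a b p phi)) |
        <= C * (dt `^ (3 / 2) + h ^+ 2)) /\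
      `| (Sint_inf D dt t i (grid t') - phi (t, x))
         - (- sup [set dt * Aop D phi t x a
                       + branch_mean (fun p =>
                           dtil D dt t x a b p * Ltil D dt t x a b p phi)
                       - branch_mean (fun p =>
                           dtil D dt t x a b p ^+ 2 * Rtil D dt t x a b p phi)
                  | a in ctrlA D & b in ctrlB D]) |
      <= C * (dt `^ (3 / 2) + h ^+ 2)) /\
    (forall i : 'I_(nverts (Mh h)), boundary (dom D) (vert i) ->
      let x := vert i in
      `| (Sbd D (ell h) t i (grid t) - phi (t, x))
         - (- (ell h * sup [set Lop D t x (grad (fun y => phi (t, y)) x)
                                    (phi (t, x)) b | b in ctrlB D])) |
      <= C * h ^+ 2)].
Proof.
have [K [e [K1 e0 hK]]] := phi_controlled hD hphi.
have [CI HI] := family_interp hM.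
have [Ci [dt0 [dt00 Hint]]] := interior_consistency hD hphi.
have [Cb [l0 [l00 Hbd]]] := boundary_consistency hD hphi.
have c10 : 0 < c1 by exact: lt_le_trans hc0 hc01.
have K0 : 0 <= K by exact: le_trans ler01 K1.
pose Ch := `|CI| * K.
have Ch0 : 0 <= Ch by rewrite mulr_ge0.
have Cbl0 : 0 <= `|Cb| * c1 ^+ 2 by rewrite mulr_ge0 ?sqr_ge0.
pose C := `|Ci| + Ch + `|Cb| * c1 ^+ 2.
exists C, dt0, (l0 / (2 * c1)); split => //; first by rewrite divr_gt0 // mulr_gt0.
move=> NT h NT0 Hh dt dtE dtb hb n nNT t t' grid.
have h0 := family_gt0 hM Hh.
have NTp : 0 < NT%:R :> R by rewrite ltr0n.
have dtp : 0 < dt by rewrite dtE divr_gt0 // horizon_gt0.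
have dtH : NT%:R * dt = horizon D by rewrite dtE mulrC divfK // gt_eqF.
have tn m : (m <= NT)%N -> times D (m%:R * dt).
  move=> mN; rewrite /times /= mulr_ge0 ?(ltW dtp) //=.
  by rewrite -dtH ler_wpM2r ?(ltW dtp) // ler_nat.
have Tt : times D t by apply: tn; exact: ltnW.
have Tt' : times D t' by exact: tn.
have t'E : t' = t + dt by rewrite /t' -natr1 mulrDl mul1r.
have interpP s y : times D s -> closure (dom D) y ->
    `|interp (grid s) y - phi (s, y)| <= Ch * h ^+ 2.
  move=> Ts cy.
  have [Cs /andP[n0 nK]] := phi_slice_Ck_closure hD hphi hK Ts.
  apply: (le_trans (HI h Hh _ Cs y cy)); rewrite ler_wpM2r ?sqr_ge0 //.
  by apply: le_trans (ler_wpM2l (normr_ge0 CI) nK); rewrite ler_wpM2r // ler_norm.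
have h2 : 0 <= h ^+ 2 by exact: sqr_ge0.
split => [i Oi x|i Oi]; last first.
  cbv zeta; set x := vert i.
  have /andP[le1 le2] := hell h Hh.
  have lp : 0 < ell h by rewrite (lt_le_trans _ le1) // mulr_gt0.
  have ll : 0 < ell h < l0.
    rewrite lp (le_lt_trans le2) // (@le_lt_trans _ _ (l0 / 2)) //.
      rewrite (le_trans (ler_wpM2l (ltW c10) hb)) // le_eqVlt; apply/orP; left.
      by apply/eqP; field; rewrite gt_eqF.
    by rewrite ltr_pdivrMr // ltr_pMr // ltr1n.
  have key b : ctrlB D b -> _ := fun Bb =>
    Hbd t (ell h) (Ch * h ^+ 2) (interp (grid t)) x b ll Tt Oi Bb
      (fun y cy => interpP t y Tt cy).
  have CE : Cb * ell h ^+ 2 + Ch * h ^+ 2 <= C * h ^+ 2.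
    rewrite /C (_ : `|Ci| + _ + _ = `|Ci| + (`|Cb| * c1 ^+ 2 + Ch)); last by ring.
    rewrite [leRHS]mulrDl [X in _ <= _ + X]mulrDl.
    rewrite (@le_trans _ _ (`|Cb| * c1 ^+ 2 * h ^+ 2 + Ch * h ^+ 2)) //.
      rewrite lerD2r -mulrA -exprMn (le_trans (ler_norm _)) // normrM.
      rewrite ler_wpM2l // ger0_norm ?sqr_ge0 // lerXn2r ?nnegrE ?(ltW lp) //.
      by rewrite mulr_ge0 // ltW.
    by rewrite lerDr mulr_ge0.
  rewrite opprK; apply: le_trans CE.
  apply: inf_sup_perturbation (`|Cb|) _ _ _ _ => //.
  - exact: ctrlB_nonempty hD.
  - by move=> b Bb; have [_ E] := key b Bb; exact: le_trans E (ler_norm _).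
  - by move=> b Bb; have [E _] := key b Bb.
have dtb' : 0 < dt <= dt0 by rewrite dtp.
rewrite powR_three_halves //; set s3 := Num.sqrt dt ^+ 3.
have s30 : 0 <= s3 by rewrite exprn_ge0 // sqrtr_ge0.
have CE : Ci * s3 + Ch * h ^+ 2 <= C * (s3 + h ^+ 2).
  rewrite mulrDr lerD // ler_wpM2r //; last first.
    by rewrite /C addrAC lerDr addr_ge0.
  by rewrite (le_trans (ler_norm _)) // /C -addrA lerDl addr_ge0.
have key a b : ctrlA D a -> ctrlB D b -> _ := fun Aa Bb =>
  Hint dt t (Ch * h ^+ 2) (interp (grid t')) x a b dtb' Tt
    (eq_ind _ (times D) Tt' _ t'E) Oi Aa Bb
    (eq_ind _ (fun r => forall y, closure (dom D) y ->
      `|interp (grid t') y - phi (r, y)| <= Ch * h ^+ 2)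
      (fun y cy => interpP t' y Tt' cy) _ t'E).
split=> [a b Aa Bb|].
  by have [E _] := key a b Aa Bb; exact: le_trans E CE.
rewrite /Sint_inf !image2_prod opprK -[sup _]mul1r.
apply: le_trans CE; apply: inf_sup_perturbation (`|Ci|) _ _ _ _ => //.
- have [a Aa] := ctrlA_nonempty hD; have [b Bb] := ctrlB_nonempty hD.
  by exists (a, b).
- move=> [a b] [/= Aa Bb]; have [_ E] := key a b Aa Bb.
  exact: le_trans E (ler_norm _).
- move=> [a b] [/= Aa Bb]; have [E _] := key a b Aa Bb.
  by apply: le_trans E; rewrite mul1r /Sint le_eqVlt; apply/orP; left;
    apply/eqP; congr (`| _ |); ring.
Qed.
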